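(* Let $J\in\mathbb{C}^{2\times2}$ be unitary and let $G$ be the associated Green's function (defined in the context). Let $\alpha_0\in(0,\frac{\pi}{2})$, $S_{\alpha_0}=\{re^{i\theta}: r\geq0,\ 0\leq\theta\leq\alpha_0\}$, let $\Omega\subseteq\mathbb{C}$ be an open set containing $S_{\alpha_0}\cup(-S_{\alpha_0})$, and let $F,F_n:\Omega\to\mathbb{C}$, $n\in\mathbb{N}_0$, be holomorphic. Assume that there are $A,B\geq0$ and $A_n,B_n\geq0$, $n\in\mathbb{N}_0$, such that for all $z\in S_{\alpha_0}\cup(-S_{\alpha_0})$ $$|F(z)|\leq A\,e^{B|\operatorname{Im}(z)|}\quad\text{and}\quad|F_n(z)|\leq A_n\,e^{B_n|\operatorname{Im}(z)|},\ n\in\mathbb{N}_0.$$ If, for some $C\geq0$, $$\lim_{n\to\infty}\ \sup_{z\in S_{\alpha_0}\cup(-S_{\alpha_0})}\big|F_n(z)-F(z)\big|e^{-C|z|}=0,$$ then the corresponding wave functions $\Psi(t,x;\cdot)$ converge, $$\lim_{n\to\infty}\Psi(t,x;F_n)=\Psi(t,x;F),$$ uniformly on compact subsets of $(0,\infty)\times\mathbb{R}$; that is, for every compact $K\subset(0,\infty)\times\mathbb{R}$, $\sup_{(t,x)\in K,\,x\neq0}|\Psi(t,x;F_n)-\Psi(t,x;F)|\to0$ as $n\to\infty$.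
   Context: Conventions: for $t>0$, $\sqrt{it}=e^{i\pi/4}\sqrt t$ and $\sqrt{i\pi t}=e^{i\pi/4}\sqrt{\pi t}$ (principal branch); $\Theta(x)=1$ for $x>0$ and $\Theta(x)=0$ for $x<0$. The entire function $\Lambda$ is $\Lambda(z)=e^{z^2}(1-\operatorname{erf}(z))$, where $\operatorname{erf}(z)=\frac{2}{\sqrt\pi}\int_0^z e^{-\xi^2}d\xi$. Coefficients. Every unitary $J\in\mathbb{C}^{2\times2}$ has the form $J=e^{i\phi}\begin{pmatrix}\alpha&-\bar\beta\\ \beta&\bar\alpha\end{pmatrix}$ with $\phi\in[0,\pi)$, $\alpha,\beta\in\mathbb{C}$ and $|\alpha|^2+|\beta|^2=1$. For $x,y\in\mathbb{R}\setminus\{0\}$ put $\eta^{(x,y)}=0$ if $|\operatorname{Re}(\alpha)|=1$, and if $|\operatorname{Re}(\alpha)|\neq1$ put $$\eta^{(x,y)}=\frac{1}{\sqrt{1-\operatorname{Re}(\alpha)^2}}\cdot\begin{cases}-\operatorname{Im}(\alpha),&x,y>0,\\ -i\bar\beta,&x>0,\,y<0,\\ i\beta,&x<0,\,y>0,\\ \operatorname{Im}(\alpha),&x,y<0.\end{cases}$$ Case I: if $\operatorname{Re}(\alpha)\neq-\cos(\phi)$, then $\omega_\pm=\frac{-\sin(\phi)\pm\sqrt{1-\operatorname{Re}(\alpha)^2}}{\cos(\phi)+\operatorname{Re}(\alpha)}$, $\mu_\pm^{(x,y)}=-\frac{\omega_\pm}{2}\big(\Theta(xy)\pm\eta^{(x,y)}\big)$,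 $\mu_0^{(x,y)}=\operatorname{sgn}(xy)$. Case II: if $\operatorname{Re}(\alpha)=-\cos(\phi)\neq-1$, then $\omega_-=\mu_-^{(x,y)}=0$, $\omega_+=\cot(\phi)$, $\mu_+^{(x,y)}=-\frac{\omega_+}{2}\big(\Theta(xy)+\eta^{(x,y)}\big)$, $\mu_0^{(x,y)}=\eta^{(x,y)}-\Theta(-xy)$. Case III: if $\operatorname{Re}(\alpha)=-\cos(\phi)=-1$, then $\omega_\pm=\mu_\pm^{(x,y)}=0$ and $\mu_0^{(x,y)}=-1$. Green's function: for $t>0$, $x,y\in\mathbb{R}\setminus\{0\}$, $$G(t,x,y)=\Big(\mu_+^{(x,y)}\Lambda\Big(\tfrac{|x|+|y|}{2\sqrt{it}}+\omega_+\sqrt{it}\Big)+\mu_-^{(x,y)}\Lambda\Big(\tfrac{|x|+|y|}{2\sqrt{it}}+\omega_-\sqrt{it}\Big)\Big)e^{-\frac{(|x|+|y|)^2}{4it}}+\frac{1}{2\sqrt{i\pi t}}\Big(\mu_0^{(x,y)}e^{-\frac{(|x|+|y|)^2}{4it}}+e^{-\frac{(x-y)^2}{4it}}\Big).$$ Wave function: for $t>0$, $x\in\mathbb{R}\setminus\{0\}$, and $F$ holomorphic on an open set containing a double sector $S_{\alpha_0}\cup(-S_{\alpha_0})$ with $|F(z)|\le Ae^{B|\operatorname{Im}(z)|}$ there, $$\Psi(t,x;F)=\int_{\mathbb{R}}G(t,x,y)F(y)\,dy:=\lim_{R_1\to\infty}\int_{-R_1}^0G(t,x,y)F(y)\,dy+\lim_{R_2\to\infty}\int_0^{R_2}G(t,x,y)F(y)\,dy$$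 (improper Riemann integrals, which exist for such $F$). *)

(* Defs.v *)
From Stdlib Require Export Reals List.
From Coquelicot Require Export Coquelicot.

Open Scope R_scope.

(** * Complex exponential and [erf] *)

Definition Cexp (z : C) : C := (exp (Re z) * cos (Im z), exp (Re z) * sin (Im z)).

(* The integrand is entire, so the integral from 0 to z may be taken along the
   segment xi = s z, 0 <= s <= 1. *)
Definition Cerf (z : C) : C :=
  (2 / sqrt PI * RInt (V := C_R_CompleteNormedModule)
                   (fun s : R => (Cexp (- (s * z) ^ 2) * z)%C) 0 1)%C.

Definition Lambda (z : C) : C := (Cexp (z ^ 2) * (1 - Cerf z))%C.

Definition sqrt_i (s : R) : C := (Cexp (Ci * (PI / 4)%R) * sqrt s)%C.

(** * Unitary 2x2 matrices and their parameters *)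

Definition adjoint (J : @matrix C 2 2) : @matrix C 2 2 :=
  mk_matrix 2 2 (fun i j => Cconj (coeff_mat (RtoC 0) J j i)).

Definition unitary (J : @matrix C 2 2) : Prop :=
  Mmult (T := C_Ring) (adjoint J) J = Mone (T := C_Ring) /\
  Mmult (T := C_Ring) J (adjoint J) = Mone (T := C_Ring).

(* Every unitary J has exactly one such triple: det J = e^{2 i phi} fixes phi in
   [0, pi), and then the first column fixes alpha and beta. *)
Definition parameters (J : @matrix C 2 2) (phi : R) (alpha beta : C) : Prop :=
  0 <= phi < PI /\
  Cmod alpha ^ 2 + Cmod beta ^ 2 = 1 /\
  coeff_mat (RtoC 0) J 0 0 = (Cexp (Ci * phi) * alpha)%C /\
  coeff_mat (RtoC 0) J 0 1 = (Cexp (Ci * phi) * - Cconj beta)%C /\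
  coeff_mat (RtoC 0) J 1 0 = (Cexp (Ci * phi) * beta)%C /\
  coeff_mat (RtoC 0) J 1 1 = (Cexp (Ci * phi) * Cconj alpha)%C.

(** * Coefficients of the Green's function

    Only nonzero [x] and [y] are meaningful below; the values given when one of
    them vanishes are arbitrary. *)

Definition Theta (x : R) : R := if Rlt_dec 0 x then 1 else 0.

Definition eta (alpha beta : C) (x y : R) : C :=
  if Req_EM_T (Rabs (Re alpha)) 1 then RtoC 0
  else
    (RtoC (/ sqrt (1 - Re alpha ^ 2)) *
     match Rlt_dec 0 x, Rlt_dec 0 y with
     | left _, left _ => RtoC (- Im alpha)
     | left _, right _ => - Ci * Cconj beta
     | right _, left _ => Ci * beta
     | right _, right _ => RtoC (Im alpha)
     end)%C.

Inductive jump_case : Set := CaseI | CaseII | CaseIII.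

Definition case_of (phi : R) (alpha : C) : jump_case :=
  if Req_EM_T (Re alpha) (- cos phi) then
    if Req_EM_T (Re alpha) (-1) then CaseIII else CaseII
  else CaseI.

Definition omega_plus (phi : R) (alpha : C) : R :=
  match case_of phi alpha with
  | CaseI => (- sin phi + sqrt (1 - Re alpha ^ 2)) / (cos phi + Re alpha)
  | CaseII => cos phi / sin phi
  | CaseIII => 0
  end.

Definition omega_minus (phi : R) (alpha : C) : R :=
  match case_of phi alpha with
  | CaseI => (- sin phi - sqrt (1 - Re alpha ^ 2)) / (cos phi + Re alpha)
  | CaseII => 0
  | CaseIII => 0
  end.

Definition mu_plus (phi : R) (alpha beta : C) (x y : R) : C :=
  match case_of phi alpha with
  | CaseI | CaseII =>
      (- (omega_plus phi alpha / 2)%R * (Theta (x * y) + eta alpha beta x y))%C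
  | CaseIII => RtoC 0
  end.

Definition mu_minus (phi : R) (alpha beta : C) (x y : R) : C :=
  match case_of phi alpha with
  | CaseI =>
      (- (omega_minus phi alpha / 2)%R * (Theta (x * y) - eta alpha beta x y))%C
  | CaseII | CaseIII => RtoC 0
  end.

Definition mu_0 (phi : R) (alpha beta : C) (x y : R) : C :=
  match case_of phi alpha with
  | CaseI => RtoC (sign (x * y))
  | CaseII => (eta alpha beta x y - Theta (- (x * y)))%C
  | CaseIII => RtoC (-1)
  end.

(** * Green's function and wave function *)

Definition Green (phi : R) (alpha beta : C) (t x y : R) : C :=
  let s := Rabs x + Rabs y in
  let gauss (d : R) : C := Cexp (- (RtoC (d ^ 2) / (4 * Ci * t))) in
  ((mu_plus phi alpha beta x y
      * Lambda (s / (2 * sqrt_i t) + omega_plus phi alpha * sqrt_i t)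
    + mu_minus phi alpha beta x y
      * Lambda (s / (2 * sqrt_i t) + omega_minus phi alpha * sqrt_i t))
     * gauss s
   + / (2 * sqrt_i (PI * t)) * (mu_0 phi alpha beta x y * gauss s + gauss (x - y)%R))%C.

(* [RInt_gen] is the limit of Riemann integrals as the end points run along the
   two filters, i.e. the improper Riemann integral on each half-line. *)
Definition Psi (phi : R) (alpha beta : C) (t x : R) (F : C -> C) : C :=
  let f (y : R) : C := (Green phi alpha beta t x y * F (RtoC y))%C in
  (RInt_gen (V := C_R_CompleteNormedModule) f (Rbar_locally m_infty) (at_point 0)
   + RInt_gen (V := C_R_CompleteNormedModule) f (at_point 0) (Rbar_locally p_infty))%C.

(** * Domains *)

Definition sector (alpha0 : R) (z : C) : Prop :=
  exists r theta : R,
    0 <= r /\ 0 <= theta <= alpha0 /\ z = (r * Cexp (Ci * theta))%C.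

Definition double_sector (alpha0 : R) (z : C) : Prop :=
  sector alpha0 z \/ sector alpha0 (- z)%C.

Definition holomorphic_on (Omega : C -> Prop) (F : C -> C) : Prop :=
  forall z : C, Omega z -> ex_derive (K := C_AbsRing) (V := C_NormedModule) F z.

Definition compact_set {T : UniformSpace} (K : T -> Prop) : Prop :=
  forall U : (T -> Prop) -> Prop,
    (forall V, U V -> open V) ->
    (forall p, K p -> exists V, U V /\ V p) ->
    exists l : list (T -> Prop),
      (forall V, In V l -> U V) /\
      (forall p, K p -> exists V, In V l /\ V p).

(** * Suprema *)

Definition sup_over {T : Type} (D : T -> Prop) (g : T -> R) : Rbar :=
  Lub_Rbar (fun r => exists p, D p /\ r = g p).

(* Convergence to 0 of sup_D g_n for nonnegative g_n.  The supremum is an extended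
   real: it may be infinite for finitely many n, and it is -oo when D is empty. *)
Definition sup_tends_to_0 {T : Type} (D : T -> Prop) (g : nat -> T -> R) : Prop :=
  forall eps : posreal, eventually (fun n => Rbar_lt (sup_over D (g n)) eps).

(* Main.v *)
Require Import Defs.
From Stdlib Require Import Lra Lia.

(** Write the wave function as the sum of two half-line integrals, one for [y > 0]
    and one for [y < 0].  For fixed [t] and [x], the Green's function on either
    half-line is the restriction of an entire function [Green_branch], and on the
    open first quadrant this function decays like [exp (- X Y / (2 t))] at [X + i Y]:
    its Gaussian factors do, because [exp (i w^2 / (4 t))] has modulus
    [exp (- Re w Im w / (2 t))], and its factors [Lambda] stay bounded, because their
    argument has real part bounded below ([Lambda_bounded]).

    On the real axis there is no decay, and the hypothesis on [Fn - F] even allows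
    growth like [exp (C0 |y|)]; so the path of integration is turned from the half-line
    to the ray of slope [k = tan alpha0], which lies in the sector.  By Cauchy's theorem
    for the triangle with vertices [0], [r] and [r (1 + i k)], the integrals up to [r] along
    the axis and along the ray differ by the integral over the vertical side.
    There the growth [exp (B |Im z|)] of the datum loses against the decay
    [exp (- r Y / (2 t))], and the side contributes [O (1 / r)] ([rotation]).  Here the
    exponential bounds of [F] and of each [Fn] enter; their constants may depend on [n],
    because only the limits for each single [n] are identified at this point.

    On the ray the continued Green's function is bounded by a multiple of
    [exp (- c r^2 + b r)] with [c > 0].
    So [|Fn - F| <= delta exp (C0 |z|)] gives a difference of wave functions of at most
    [delta] times a constant ([Psi_stability]).  It depends on [t] and [x] only
    through bounds for [t], [1 / t] and [|x|], which exist on a compact set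
    ([compact_in_box]).

    Two classical tools are built on the way.  Cauchy's theorem for a triangle
    ([Cauchy_triangle]) is proved by Goursat's bisection, since the complex derivative of
    the data is not assumed continuous.  The bound on [Lambda] needs the value of the
    Gaussian integral: it is what makes [1 - erf] compensate the growth of [exp (z^2)]. *)

(** * Complex differentiation *)

Notation is_Cderive := (is_derive (K := C_AbsRing) (V := C_NormedModule)).
Notation ex_Cderive := (ex_derive (K := C_AbsRing) (V := C_NormedModule)).
Notation CRInt := (RInt (V := C_R_CompleteNormedModule)).
Notation is_CRInt := (is_RInt (V := C_R_NormedModule)).
Notation ex_CRInt := (ex_RInt (V := C_R_NormedModule)).

(** Values of integrals have the carrier of a normed module as their type, where [ring] finds
    no ring structure; this states the equation in the convertible type [T]. *)
Ltac eq_in T := match goal with |- @eq _ ?x ?y => change (@eq T x y) end.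

Lemma norm_C_R (z : C) : norm (V := C_R_NormedModule) z = Cmod z.
Proof.
  change (sqrt (Rabs (fst z) ^ 2 + Rabs (snd z) ^ 2) = Cmod z).
  now rewrite 2!pow2_abs.
Qed.

Lemma is_Cderive_iff (f : C -> C) (z l : C) :
  is_Cderive f z l <->
  forall eps, 0 < eps -> exists d, 0 < d /\
    forall w, Cmod (w - z) < d ->
      Cmod (f w - f z - (w - z) * l) <= eps * Cmod (w - z).
Proof.
  split.
  - intros [_ H] eps Heps.
    destruct (H z (fun P HP => HP) (mkposreal eps Heps)) as [d Hd].
    exists d; split; [apply cond_pos|]. exact Hd.
  - intros H; split; [apply is_linear_scal_l|].
    intros z' Hz' eps.
    rewrite <- (is_filter_lim_locally_unique (V := AbsRing_NormedModule C_AbsRing) z z' Hz').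
    destruct (H eps (cond_pos eps)) as [d [Hd Hw]].
    exists (mkposreal d Hd). exact Hw.
Qed.

(** The product rule and the chain rule of the library speak of the norm structure that a
    ring with absolute value has over itself.  That structure and [C_NormedModule] have the
    same norm, and the derivative depends on nothing else of the target. *)
Lemma is_Cderive_AbsRing (f : C -> C) (z l : C) :
  is_Cderive f z l <->
  is_derive (K := C_AbsRing) (V := AbsRing_NormedModule C_AbsRing) f z l.
Proof.
  split; intros [_ H]; (split; [apply is_linear_scal_l | exact H]).
Qed.

Lemma is_Cderive_const (c z : C) : is_Cderive (fun _ => c) z (RtoC 0).
Proof. exact (is_derive_const (K := C_AbsRing) (V := C_NormedModule) c z). Qed.

Lemma is_Cderive_id (z : C) : is_Cderive (fun w => w) z (RtoC 1).
Proof. apply is_Cderive_AbsRing. exact (is_derive_id (K := C_AbsRing) z). Qed.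

Lemma is_Cderive_plus (f g : C -> C) (z l m : C) :
  is_Cderive f z l -> is_Cderive g z m ->
  is_Cderive (fun w => f w + g w)%C z (l + m)%C.
Proof. exact (is_derive_plus (K := C_AbsRing) (V := C_NormedModule) f g z l m). Qed.

Lemma is_Cderive_mult (f g : C -> C) (z l m : C) :
  is_Cderive f z l -> is_Cderive g z m ->
  is_Cderive (fun w => f w * g w)%C z (l * g z + f z * m)%C.
Proof.
  rewrite !is_Cderive_AbsRing. intros Hf Hg.
  exact (is_derive_mult f g z l m Hf Hg Cmult_comm).
Qed.

Lemma is_Cderive_comp (f g : C -> C) (z l m : C) :
  is_Cderive f (g z) l -> is_Cderive g z m ->
  is_Cderive (fun w => f (g w)) z (m * l)%C.
Proof.
  intros Hf Hg. apply is_Cderive_AbsRing in Hg.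
  exact (is_derive_comp f g z l m Hf Hg).
Qed.

Lemma is_Cderive_eq (f : C -> C) (z l m : C) :
  is_Cderive f z l -> l = m -> is_Cderive f z m.
Proof. now intros H <-. Qed.

Lemma ex_Cderive_const (c z : C) : ex_Cderive (fun _ => c) z.
Proof. eexists; apply is_Cderive_const. Qed.

Lemma ex_Cderive_id (z : C) : ex_Cderive (fun w => w) z.
Proof. eexists; apply is_Cderive_id. Qed.

Lemma ex_Cderive_plus (f g : C -> C) (z : C) :
  ex_Cderive f z -> ex_Cderive g z -> ex_Cderive (fun w => f w + g w)%C z.
Proof. intros [l Hl] [m Hm]; eexists; apply is_Cderive_plus; eassumption. Qed.

Lemma ex_Cderive_mult (f g : C -> C) (z : C) :
  ex_Cderive f z -> ex_Cderive g z -> ex_Cderive (fun w => f w * g w)%C z.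
Proof. intros [l Hl] [m Hm]; eexists; apply is_Cderive_mult; eassumption. Qed.

Lemma ex_Cderive_comp (f g : C -> C) (z : C) :
  ex_Cderive f (g z) -> ex_Cderive g z -> ex_Cderive (fun w => f (g w)) z.
Proof. intros [l Hl] [m Hm]; eexists; apply is_Cderive_comp; eassumption. Qed.

Lemma ex_Cderive_ext (f g : C -> C) (z : C) :
  (forall w, f w = g w) -> ex_Cderive f z -> ex_Cderive g z.
Proof. exact (ex_derive_ext (K := C_AbsRing) (V := C_NormedModule) f g z). Qed.

Lemma Cexp_plus (z w : C) : Cexp (z + w) = (Cexp z * Cexp w)%C.
Proof.
  destruct z as [a b], w as [c d]; unfold Cexp, Re, Im, Cmult, Cplus; cbn.
  rewrite exp_plus, cos_plus, sin_plus. f_equal; ring.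
Qed.

Lemma Cexp_0 : Cexp 0 = 1.
Proof. unfold Cexp, Re, Im; cbn. rewrite exp_0, cos_0, sin_0. unfold RtoC; f_equal; ring. Qed.

Lemma Cmod_Cexp (z : C) : Cmod (Cexp z) = exp (Re z).
Proof.
  unfold Cmod, Cexp; cbn [fst snd].
  replace ((exp (Re z) * cos (Im z)) ^ 2 + (exp (Re z) * sin (Im z)) ^ 2)
    with (exp (Re z) ^ 2 * (Rsqr (sin (Im z)) + Rsqr (cos (Im z))))
    by (unfold Rsqr; ring).
  rewrite sin2_cos2, Rmult_1_r. apply sqrt_pow2, Rlt_le, exp_pos.
Qed.

Lemma Cexp_RtoC (x : R) : Cexp x = exp x.
Proof. unfold Cexp, RtoC, Re, Im; cbn. rewrite cos_0, sin_0. f_equal; ring. Qed.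

Lemma Cmod_le_sum (z : C) : Cmod z <= Rabs (fst z) + Rabs (snd z).
Proof.
  rewrite <- (Cmod_R (fst z)), <- (Rmult_1_l (Rabs (snd z))), <- Cmod_Ci,
    <- (Cmod_R (snd z)), <- Cmod_mult.
  eapply Rle_trans; [|apply Cmod_triangle].
  apply Req_le; f_equal. destruct z; unfold Cplus, Cmult, Ci, RtoC; cbn; f_equal; ring.
Qed.

Lemma fst_le_Cmod (z : C) : Rabs (fst z) <= Cmod z.
Proof. eapply Rle_trans; [apply Rmax_l|apply Rmax_Cmod]. Qed.

Lemma snd_le_Cmod (z : C) : Rabs (snd z) <= Cmod z.
Proof. eapply Rle_trans; [apply Rmax_r|apply Rmax_Cmod]. Qed.

Lemma is_derive_eps (f : R -> R) (x l : R) :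
  is_derive f x l -> forall eps, 0 < eps -> exists d, 0 < d /\
    forall h, Rabs h < d -> Rabs (f (x + h) - f x - l * h) <= eps * Rabs h.
Proof.
  intros H eps Heps. apply is_derive_Reals in H.
  destruct (H eps Heps) as [d Hd]. exists d; split; [apply cond_pos|].
  intros h Hh. destruct (Req_dec h 0) as [->|Hh0].
  - rewrite Rplus_0_r, Rabs_R0. replace (f x - f x - l * 0) with 0 by ring.
    rewrite Rabs_R0; lra.
  - specialize (Hd h Hh0 Hh).
    replace (f (x + h) - f x - l * h) with (((f (x + h) - f x) / h - l) * h)
      by (field; assumption).
    rewrite Rabs_mult. apply Rmult_le_compat_r; [apply Rabs_pos|lra].
Qed.

(** The only place where the definition of the exponential through [exp], [cos] and [sin]
    is differentiated; elsewhere the functional equation transports this case. *)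
Lemma is_Cderive_Cexp_0 : is_Cderive Cexp (RtoC 0) (RtoC 1).
Proof.
  apply is_Cderive_iff. intros eps Heps.
  (* Nine error terms of size at most eps / 12 * Cmod w add up below. *)
  assert (He12 : 0 < Rmin 1 (eps / 12)) by (apply Rmin_pos; lra).
  destruct (is_derive_eps exp 0 1 ltac:(auto_derive; [trivial|rewrite exp_0; ring]) _ He12)
    as [d1 [Hd1 H1]].
  destruct (is_derive_eps cos 0 0 ltac:(auto_derive; [trivial|rewrite sin_0; ring]) _ He12)
    as [d2 [Hd2 H2]].
  destruct (is_derive_eps sin 0 1 ltac:(auto_derive; [trivial|rewrite cos_0; ring]) _ He12)
    as [d3 [Hd3 H3]].
  set (e := Rmin 1 (eps / 12)) in *.
  assert (He1 : e <= 1) by apply Rmin_l.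
  assert (He2 : e <= eps / 12) by apply Rmin_r.
  exists (Rmin (Rmin d1 d2) (Rmin d3 (Rmin 1 (eps / 12)))). split.
  { repeat apply Rmin_pos; lra. }
  intros [a b] Hw.
  replace ((a, b) - 0)%C with ((a, b) : C) in *
    by (unfold Cminus, Cplus, Copp, RtoC; cbn; f_equal; ring).
  rewrite Cexp_0.
  assert (Ha := fst_le_Cmod (a, b)). assert (Hb := snd_le_Cmod (a, b)). cbn [fst snd] in *.
  set (m := Cmod (a, b)) in *.
  assert (Hm0 : 0 <= m) by apply Cmod_ge_0.
  assert (Hm : m < d1 /\ m < d2 /\ m < d3 /\ m < 1 /\ m < eps / 12).
  { repeat split; eapply Rlt_le_trans; try apply Hw.
    - eapply Rle_trans; [apply Rmin_l|apply Rmin_l].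
    - eapply Rle_trans; [apply Rmin_l|apply Rmin_r].
    - eapply Rle_trans; [apply Rmin_r|apply Rmin_l].
    - eapply Rle_trans; [apply Rmin_r|eapply Rle_trans; [apply Rmin_r|apply Rmin_l]].
    - eapply Rle_trans; [apply Rmin_r|eapply Rle_trans; [apply Rmin_r|apply Rmin_r]]. }
  specialize (H1 a ltac:(lra)). specialize (H2 b ltac:(lra)). specialize (H3 b ltac:(lra)).
  rewrite !Rplus_0_l in *. rewrite exp_0 in H1. rewrite cos_0 in H2. rewrite sin_0 in H3.
  assert (K1 : Rabs (exp a - 1 - 1 * a) <= e * m)
    by (eapply Rle_trans; [apply H1|apply Rmult_le_compat_l; lra]).
  assert (K2 : Rabs (cos b - 1 - 0 * b) <= e * m)
    by (eapply Rle_trans; [apply H2|apply Rmult_le_compat_l; lra]).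
  assert (K3 : Rabs (sin b - 0 - 1 * b) <= e * m)
    by (eapply Rle_trans; [apply H3|apply Rmult_le_compat_l; lra]).
  clear H1 H2 H3.
  assert (Hem : e * m <= eps / 12 * m) by (apply Rmult_le_compat_r; lra).
  assert (Hem1 : e * m <= m) by nra.
  assert (Hex : Rabs (exp a) <= 3).
  { replace (exp a) with ((exp a - 1 - 1 * a) + (1 + a)) by ring.
    eapply Rle_trans; [apply Rabs_triang|].
    assert (Rabs (1 + a) <= 1 + m) by (eapply Rle_trans; [apply Rabs_triang|rewrite Rabs_R1; lra]).
    lra. }
  eapply Rle_trans; [apply Cmod_le_sum|].
  unfold Cexp, Cminus, Cplus, Copp, Cmult, RtoC, Re, Im; cbn [fst snd].
  replace (exp a * cos b + - (1) + - (a * 1 - b * 0))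
    with ((exp a - 1 - 1 * a) + exp a * (cos b - 1 - 0 * b)) by ring.
  replace (exp a * sin b + - 0 + - (a * 0 + b * 1))
    with (exp a * (sin b - 0 - 1 * b) + (exp a - 1 - 1 * a) * b + a * b) by ring.
  assert (R1 : Rabs (exp a * (cos b - 1 - 0 * b)) <= 3 * (e * m)).
  { rewrite Rabs_mult. apply Rmult_le_compat; auto using Rabs_pos. }
  assert (R2 : Rabs (exp a * (sin b - 0 - 1 * b)) <= 3 * (e * m)).
  { rewrite Rabs_mult. apply Rmult_le_compat; auto using Rabs_pos. }
  assert (R3 : Rabs ((exp a - 1 - 1 * a) * b) <= e * m).
  { rewrite Rabs_mult, <- (Rmult_1_r (e * m)).
    apply Rmult_le_compat; auto using Rabs_pos; lra. }
  assert (R4 : Rabs (a * b) <= eps / 12 * m).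
  { rewrite Rabs_mult. apply Rmult_le_compat; auto using Rabs_pos; lra. }
  assert (T1 := Rabs_triang (exp a - 1 - 1 * a) (exp a * (cos b - 1 - 0 * b))).
  assert (T2 := Rabs_triang (exp a * (sin b - 0 - 1 * b) + (exp a - 1 - 1 * a) * b) (a * b)).
  assert (T3 := Rabs_triang (exp a * (sin b - 0 - 1 * b)) ((exp a - 1 - 1 * a) * b)).
  assert (0 <= eps * m) by (apply Rmult_le_pos; lra). lra.
Qed.

Lemma is_Cderive_Cexp (z : C) : is_Cderive Cexp z (Cexp z).
Proof.
  assert (H : is_Cderive (fun w => Cexp z * Cexp (w + - z))%C z (Cexp z)).
  { eapply is_Cderive_eq.
    - apply is_Cderive_mult; [apply is_Cderive_const|].
      apply (is_Cderive_comp Cexp (fun w => w + - z)%C z 1 1).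
      + replace (z + - z)%C with (RtoC 0) by ring. apply is_Cderive_Cexp_0.
      + eapply is_Cderive_eq; [apply is_Cderive_plus;
          [apply is_Cderive_id|apply is_Cderive_const]|ring].
    - cbn beta. ring. }
  eapply is_derive_ext; [|exact H]. intros w; cbn beta. rewrite <- Cexp_plus. f_equal; ring.
Qed.

(** * Integrals along straight lines *)

(** Restricting a complex derivative to a real line gives access to the fundamental theorem
    of calculus and to continuity, hence integrability, of functions of a real variable. *)
Lemma is_derive_along_line (f : C -> C) (u v l : C) (s : R) :
  is_Cderive f (u + s * v)%C l ->
  is_derive (K := R_AbsRing) (V := C_R_NormedModule)
    (fun s : R => f (u + s * v)%C) s (l * v)%C.
Proof.
  intros H. split; [apply is_linear_scal_l|].
  intros s' Hs' eps.
  rewrite <- (is_filter_lim_locally_unique (V := R_NormedModule) s s' Hs'). clear s' Hs'.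
  assert (Hv := Cmod_ge_0 v).
  assert (He : 0 < eps / (Cmod v + 1)) by (apply Rdiv_lt_0_compat; [apply cond_pos|lra]).
  destruct (proj1 (is_Cderive_iff _ _ _) H _ He) as [d [Hd Hw]].
  assert (Hd' : 0 < d / (Cmod v + 1)) by (apply Rdiv_lt_0_compat; lra).
  exists (mkposreal _ Hd'). intros r Hr.
  change (Rabs (r - s) < d / (Cmod v + 1)) in Hr.
  change (norm (V := C_R_NormedModule) (f (u + r * v) - f (u + s * v)
    - (((r - s) * fst (l * v)%C)%R, ((r - s) * snd (l * v)%C)%R))%C
    <= eps * Rabs (r - s)).
  rewrite norm_C_R.
  assert (Hrw : (u + r * v - (u + s * v))%C = (RtoC (r - s) * v)%C) by (rewrite RtoC_minus; ring).
  specialize (Hw (u + r * v)%C). rewrite Hrw in Hw.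
  rewrite Cmod_mult, Cmod_R in Hw.
  replace ((((r - s) * fst (l * v)%C)%R, ((r - s) * snd (l * v)%C)%R) : C)
    with (RtoC (r - s) * v * l)%C.
  2: { destruct l, v; unfold Cmult, RtoC; cbn; f_equal; ring. }
  eapply Rle_trans; [apply Hw|].
  - apply Rle_lt_trans with (Rabs (r - s) * (Cmod v + 1)).
    + apply Rmult_le_compat_l; [apply Rabs_pos|lra].
    + apply Rlt_div_r in Hr; lra.
  - replace (pos eps * Rabs (r - s)) with (eps / (Cmod v + 1) * (Rabs (r - s) * (Cmod v + 1))) by (field; lra).
    apply Rmult_le_compat_l; [lra|].
    apply Rmult_le_compat_l; [apply Rabs_pos|lra].
Qed.

Lemma continuous_along_line (f : C -> C) (u v : C) (s : R) :
  ex_Cderive f (u + s * v)%C ->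
  continuous (U := C_R_NormedModule) (fun s : R => f (u + s * v)%C) s.
Proof.
  intros [l Hl].
  apply (ex_derive_continuous (K := R_AbsRing) (V := C_R_NormedModule)).
  eexists; apply is_derive_along_line, Hl.
Qed.

Definition line_int (f : C -> C) (u v : C) (a b : R) : C :=
  CRInt (fun s : R => f (u + s * v) * v)%C a b.

Definition on_line (P : C -> Prop) (u v : C) (a b : R) : Prop :=
  forall s : R, Rmin a b <= s <= Rmax a b -> P (u + s * v)%C.

Lemma ex_line_int (f : C -> C) (u v : C) (a b : R) :
  on_line (ex_Cderive f) u v a b ->
  ex_CRInt (fun s : R => f (u + s * v) * v)%C a b.
Proof.
  intros H. apply (ex_RInt_continuous (V := C_R_CompleteNormedModule)).
  intros s Hs.
  apply (continuous_along_line (fun z => f z * v)%C).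
  apply ex_Cderive_mult; [apply H, Hs|apply ex_Cderive_const].
Qed.

Lemma line_int_Chasles (f : C -> C) (u v : C) (a b c : R) :
  on_line (ex_Cderive f) u v a b -> on_line (ex_Cderive f) u v b c ->
  line_int f u v a c = (line_int f u v a b + line_int f u v b c)%C.
Proof.
  intros H1 H2. symmetry.
  apply (RInt_Chasles (V := C_R_CompleteNormedModule)); now apply ex_line_int.
Qed.

Lemma line_int_FTC (G g : C -> C) (u v : C) (a b : R) :
  on_line (fun z => is_Cderive G z (g z)) u v a b ->
  on_line (ex_Cderive g) u v a b ->
  line_int g u v a b = (G (u + b * v) - G (u + a * v))%C.
Proof.
  intros H1 H2. apply (is_RInt_unique (V := C_R_CompleteNormedModule)).
  apply (is_RInt_derive (V := C_R_CompleteNormedModule) (fun s : R => G (u + s * v)%C)).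
  - intros s Hs. apply is_derive_along_line, H1, Hs.
  - intros s Hs. apply (continuous_along_line (fun z => g z * v)%C).
    apply ex_Cderive_mult; [apply H2, Hs|apply ex_Cderive_const].
Qed.

Lemma Cmod_RInt_le_const (f : R -> C) (a b M : R) :
  a <= b -> ex_CRInt f a b -> (forall s, a <= s <= b -> Cmod (f s) <= M) ->
  Cmod (CRInt f a b) <= (b - a) * M.
Proof.
  intros Hab Hf HM. rewrite <- norm_C_R.
  apply (norm_RInt_le_const (V := C_R_NormedModule) f); [assumption| |].
  - intros s Hs. rewrite norm_C_R. now apply HM.
  - apply (RInt_correct (V := C_R_CompleteNormedModule)), Hf.
Qed.

Lemma Cmod_RInt_le (f : R -> C) (g : R -> R) (a b : R) :
  a <= b -> ex_CRInt f a b -> ex_RInt g a b ->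
  (forall s, a <= s <= b -> Cmod (f s) <= g s) ->
  Cmod (CRInt f a b) <= RInt g a b.
Proof.
  intros Hab Hf Hg HM. rewrite <- norm_C_R.
  apply (norm_RInt_le (V := C_R_NormedModule) f g a b); [assumption| | |].
  - intros s Hs. rewrite norm_C_R. now apply HM.
  - apply (RInt_correct (V := C_R_CompleteNormedModule)), Hf.
  - apply (RInt_correct (V := R_CompleteNormedModule)), Hg.
Qed.

Lemma CRInt_minus (f g : R -> C) (a b : R) :
  ex_CRInt f a b -> ex_CRInt g a b ->
  CRInt (fun s => f s - g s)%C a b = (CRInt f a b - CRInt g a b)%C.
Proof. exact (RInt_minus (V := C_R_CompleteNormedModule) f g a b). Qed.

Lemma line_int_minus (f g : C -> C) (u v : C) (a b : R) :
  on_line (ex_Cderive f) u v a b -> on_line (ex_Cderive g) u v a b ->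
  line_int (fun z => f z - g z)%C u v a b = (line_int f u v a b - line_int g u v a b)%C.
Proof.
  intros Hf Hg. unfold line_int.
  rewrite <- CRInt_minus by now apply ex_line_int.
  apply (RInt_ext (V := C_R_CompleteNormedModule)). intros; cbn beta.
  eq_in C. ring.
Qed.

Lemma line_int_le_const (f : C -> C) (u v : C) (a b M : R) :
  a <= b -> on_line (ex_Cderive f) u v a b ->
  on_line (fun z => Cmod (f z) <= M) u v a b ->
  Cmod (line_int f u v a b) <= (b - a) * (M * Cmod v).
Proof.
  intros Hab Hf HM. apply Cmod_RInt_le_const; [assumption|now apply ex_line_int|].
  intros s Hs. rewrite Cmod_mult. apply Rmult_le_compat_r; [apply Cmod_ge_0|].
  apply HM. rewrite Rmin_left, Rmax_right; lra.
Qed.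

(** * Cauchy's theorem for triangles *)

(** If [I] is additive and of modulus at least [M h^2] on the square at [p], then it has
    modulus at least [M (h / 2)^2] on the selected quarter. *)
Definition bisect (I : R -> R -> R -> C) (M h : R) (p : R * R) : R * R :=
  let k := h / 2 in
  let (a, c) := p in
  if Rle_dec (M * k ^ 2) (Cmod (I a c k)) then (a, c)
  else if Rle_dec (M * k ^ 2) (Cmod (I (a + k) c k)) then (a + k, c)
  else if Rle_dec (M * k ^ 2) (Cmod (I a (c + k) k)) then (a, c + k)
  else (a + k, c + k).

Fixpoint bisections (I : R -> R -> R -> C) (M : R) (n : nat) : R * R :=
  match n with
  | O => (0, 0)
  | S n => bisect I M ((1 / 2) ^ n) (bisections I M n)
  end.

(** The common point of nested intervals [[u n, u n + 2^-n]] is the supremum of their left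
    end points. *)
Lemma nested_halving (u : nat -> R) :
  (forall n, u n <= u (S n) /\ u (S n) + (1 / 2) ^ S n <= u n + (1 / 2) ^ n) ->
  exists l, forall n, u n <= l <= u n + (1 / 2) ^ n.
Proof.
  intros H.
  assert (Hpos : forall n, 0 < (1 / 2) ^ n) by (intros n; apply pow_lt; lra).
  assert (Hm : forall n k, u n <= u (n + k)%nat /\
                 u (n + k)%nat + (1 / 2) ^ (n + k) <= u n + (1 / 2) ^ n).
  { intros n k; induction k as [|k IH].
    - rewrite Nat.add_0_r; lra.
    - rewrite Nat.add_succ_r. specialize (H (n + k)%nat). lra. }
  assert (Hub : forall n m, u m <= u n + (1 / 2) ^ n).
  { intros n m. destruct (Nat.le_ge_cases n m) as [Hle|Hle].
    - specialize (Hm n (m - n)%nat). replace (n + (m - n))%nat with m in Hm by lia.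
      specialize (Hpos m). lra.
    - specialize (Hm m (n - m)%nat). replace (m + (n - m))%nat with n in Hm by lia.
      specialize (Hpos n). lra. }
  destruct (completeness (fun x => exists m, x = u m)) as [l [Hl1 Hl2]].
  - exists (u 0%nat + (1 / 2) ^ 0). intros x [m ->]. apply Hub.
  - exists (u 0%nat), 0%nat; reflexivity.
  - exists l. intros n; split.
    + apply Hl1. now exists n.
    + apply Hl2. intros x [m ->]. apply Hub.
Qed.

(** The heart of Goursat's argument, freed of complex analysis: if a function of squares is
    additive and is [o (h^2)] on squares of side [h] shrinking to a point, then it is zero.
    Otherwise one of the four quarters always keeps at least the share [M h^2] of the
    modulus, and at the common point of the squares selected in this way the local
    estimate fails. *)
Lemma square_additive_vanishes (I : R -> R -> R -> C) :
  (forall a c k, 0 <= a -> 0 <= c -> 0 < k -> a + 2 * k <= 1 -> c + 2 * k <= 1 ->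
     I a c (2 * k) =
       (I a c k + I (a + k)%R c k + I a (c + k)%R k + I (a + k)%R (c + k)%R k)%C) ->
  (forall u v eps, 0 <= u <= 1 -> 0 <= v <= 1 -> 0 < eps ->
     exists d, 0 < d /\ forall a c h, 0 <= a <= u -> u <= a + h <= 1 ->
       0 <= c <= v -> v <= c + h <= 1 -> 0 < h < d ->
       Cmod (I a c h) <= eps * h ^ 2) ->
  I 0 0 1 = 0.
Proof.
  intros Hadd Hloc. apply Cmod_eq_0.
  destruct (Rle_lt_or_eq_dec 0 _ (Cmod_ge_0 (I 0 0 1))) as [HM|HM]; [|now symmetry].
  exfalso. set (M := Cmod (I 0 0 1)) in *.
  set (p := bisections I M).
  assert (Hpos : forall n, 0 < (1 / 2) ^ n) by (intros n; apply pow_lt; lra).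
  assert (Hstep : forall n, let h := (1 / 2) ^ n in let (a, c) := p n in
    0 <= a /\ 0 <= c /\ a + h <= 1 /\ c + h <= 1 /\ M * h ^ 2 <= Cmod (I a c h)).
  { induction n as [|n IH].
    - simpl. fold M. lra.
    - cbv zeta in *.
      change (p (S n)) with (bisect I M ((1 / 2) ^ n) (p n)).
      replace ((1 / 2) ^ S n) with ((1 / 2) ^ n / 2) by (simpl; field).
      specialize (Hpos n). destruct (p n) as [a c]. unfold bisect.
      set (h := (1 / 2) ^ n) in *.
      set (k := h / 2).
      assert (Hk : h = 2 * k) by (unfold k; field).
      destruct IH as [H1 [H2 [H3 [H4 H5]]]].
      repeat destruct Rle_dec; repeat split; try lra.
      rewrite Hk, Hadd in H5 by lra.
      assert (T1 := Cmod_triangle (I a c k + I (a + k)%R c k + I a (c + k)%R k) (I (a + k)%R (c + k)%R k)).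
      assert (T2 := Cmod_triangle (I a c k + I (a + k)%R c k) (I a (c + k)%R k)).
      assert (T3 := Cmod_triangle (I a c k) (I (a + k)%R c k)).
      nra. }
  assert (Hmono : forall n, (fst (p n) <= fst (p (S n)) /\
      fst (p (S n)) + (1 / 2) ^ S n <= fst (p n) + (1 / 2) ^ n) /\
     (snd (p n) <= snd (p (S n)) /\
      snd (p (S n)) + (1 / 2) ^ S n <= snd (p n) + (1 / 2) ^ n)).
  { intros n. change (p (S n)) with (bisect I M ((1 / 2) ^ n) (p n)).
    replace ((1 / 2) ^ S n) with ((1 / 2) ^ n / 2) by (simpl; field).
    specialize (Hpos n). destruct (p n) as [a c]. unfold bisect.
    repeat destruct Rle_dec; cbn [fst snd]; lra. }
  destruct (nested_halving (fun n => fst (p n)) (fun n => proj1 (Hmono n))) as [u Hu].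
  destruct (nested_halving (fun n => snd (p n)) (fun n => proj2 (Hmono n))) as [v Hv].
  destruct (Hloc u v (M / 2)) as [d [Hd Hsmall]].
  { specialize (Hu 0%nat). simpl in Hu. lra. }
  { specialize (Hv 0%nat). simpl in Hv. lra. }
  { lra. }
  destruct (pow_lt_1_zero (1 / 2) ltac:(rewrite Rabs_pos_eq; lra) d Hd) as [N HN].
  specialize (HN N (Nat.le_refl N)). specialize (Hstep N). specialize (Hpos N).
  specialize (Hu N). specialize (Hv N). cbv beta zeta in *.
  rewrite Rabs_pos_eq in HN by lra.
  destruct (p N) as [a c]. cbn [fst snd] in *.
  specialize (Hsmall a c ((1 / 2) ^ N) ltac:(lra) ltac:(lra) ltac:(lra) ltac:(lra) ltac:(lra)).
  assert (0 < ((1 / 2) ^ N) ^ 2) by (apply pow_lt; assumption).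
  nra.
Qed.

(** The map [(x, s) |-> x (p + s d)] carries the unit square onto the triangle with vertices
    [0], [p] and [p + d], and maps lines parallel to the sides to straight lines.  Subdividing
    the square in this chart keeps every piece of the boundary inside the triangle and makes
    additivity a matter of splitting intervals. *)
Definition cell_boundary (f : C -> C) (p d : C) (a c h : R) : C :=
  (line_int f 0 (p + c * d) a (a + h) + line_int f (RtoC (a + h) * p) (RtoC (a + h) * d) c (c + h)
   - line_int f 0 (p + RtoC (c + h) * d) a (a + h) - line_int f (a * p) (a * d) c (c + h))%C.

Definition on_triangle (p d : C) (P : C -> Prop) : Prop :=
  forall x s : R, 0 <= x <= 1 -> 0 <= s <= 1 -> P (x * (p + s * d))%C.

Lemma on_triangle_ray (P : C -> Prop) (p d : C) (c a b : R) :
  on_triangle p d P -> 0 <= c <= 1 -> 0 <= a <= b -> b <= 1 -> on_line P 0 (p + c * d)%C a b.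
Proof.
  intros H Hc Ha Hb x Hx. rewrite Rmin_left, Rmax_right in Hx by lra.
  replace (0 + x * (p + c * d))%C with (x * (p + c * d))%C by ring. apply H; lra.
Qed.

Lemma on_triangle_transversal (P : C -> Prop) (p d : C) (a c e : R) :
  on_triangle p d P -> 0 <= a <= 1 -> 0 <= c <= e -> e <= 1 -> on_line P (a * p)%C (a * d)%C c e.
Proof.
  intros H Ha Hc He s Hs. rewrite Rmin_left, Rmax_right in Hs by lra.
  replace (a * p + s * (a * d))%C with (a * (p + s * d))%C by ring. apply H; lra.
Qed.

Lemma cell_boundary_additive (f : C -> C) (p d : C) (a c k : R) :
  on_triangle p d (ex_Cderive f) ->
  0 <= a -> 0 <= c -> 0 < k -> a + 2 * k <= 1 -> c + 2 * k <= 1 ->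
  cell_boundary f p d a c (2 * k) =
    (cell_boundary f p d a c k + cell_boundary f p d (a + k) c k +
     cell_boundary f p d a (c + k) k + cell_boundary f p d (a + k) (c + k) k)%C.
Proof.
  intros Hf Ha Hc Hk Ha1 Hc1. unfold cell_boundary.
  replace (a + 2 * k)%R with (a + k + k)%R by ring.
  replace (c + 2 * k)%R with (c + k + k)%R by ring.
  assert (HX : forall e, 0 <= e <= 1 -> line_int f 0 (p + RtoC e * d)%C a (a + k + k) =
    (line_int f 0 (p + RtoC e * d)%C a (a + k)
     + line_int f 0 (p + RtoC e * d)%C (a + k) (a + k + k))%C).
  { intros e He. apply line_int_Chasles; apply on_triangle_ray; auto; lra. }
  assert (HV : forall b, 0 <= b <= 1 -> line_int f (RtoC b * p)%C (RtoC b * d)%C c (c + k + k) =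
    (line_int f (RtoC b * p)%C (RtoC b * d)%C c (c + k)
     + line_int f (RtoC b * p)%C (RtoC b * d)%C (c + k) (c + k + k))%C).
  { intros b Hb. apply line_int_Chasles; apply on_triangle_transversal; auto; lra. }
  rewrite !HX, !HV by lra. ring.
Qed.

Lemma cell_boundary_minus (f g : C -> C) (p d : C) (a c h : R) :
  on_triangle p d (ex_Cderive f) -> on_triangle p d (ex_Cderive g) ->
  0 <= a -> 0 <= c -> 0 < h -> a + h <= 1 -> c + h <= 1 ->
  cell_boundary (fun z => f z - g z)%C p d a c h =
  (cell_boundary f p d a c h - cell_boundary g p d a c h)%C.
Proof.
  intros Hf Hg Ha Hc Hh Ha1 Hc1. unfold cell_boundary.
  rewrite !line_int_minus;
    try (apply on_triangle_ray; auto; lra); try (apply on_triangle_transversal; auto; lra).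
  ring.
Qed.

(** The affine part of [f] at a point integrates to zero around every cell, because it has a
    primitive. *)
Lemma cell_boundary_FTC (G g : C -> C) (p d : C) (a c h : R) :
  (forall z, is_Cderive G z (g z)) -> (forall z, ex_Cderive g z) ->
  cell_boundary g p d a c h = 0.
Proof.
  intros HG Hg. unfold cell_boundary.
  rewrite !(line_int_FTC G g); try (intros s _; apply HG); try (intros s _; apply Hg).
  rewrite !RtoC_plus.
  replace (0 + (a + h) * (p + c * d))%C with ((a + h) * p + c * ((a + h) * d))%C by ring.
  replace (0 + (a + h) * (p + (c + h) * d))%C with ((a + h) * p + (c + h) * ((a + h) * d))%C by ring.
  replace (0 + a * (p + c * d))%C with (a * p + c * (a * d))%C by ring.
  replace (0 + a * (p + (c + h) * d))%C with (a * p + (c + h) * (a * d))%C by ring.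
  ring.
Qed.

(** The chart is Lipschitz, so a cell of side [h] around a point has diameter [O (h)]; with a
    remainder [o (h)] of [f] and a perimeter [O (h)] this gives the bound [o (h^2)] of
    [square_additive_vanishes]. *)
Lemma Cmod_chart_dist (p d : C) (x s u v h : R) :
  0 <= u <= 1 -> 0 <= s <= 1 -> Rabs (x - u) <= h -> Rabs (s - v) <= h ->
  Cmod (x * (p + s * d) - u * (p + v * d)) <= 2 * h * (Cmod p + Cmod d).
Proof.
  intros Hu Hs Hx Hv.
  replace (x * (p + s * d) - u * (p + v * d))%C
    with (RtoC (x - u) * p + (RtoC (x - u) * s * d + u * RtoC (s - v) * d))%C
    by (rewrite !RtoC_minus; ring).
  eapply Rle_trans; [apply Cmod_triangle|].
  assert (T := Cmod_triangle (RtoC (x - u) * s * d) (u * RtoC (s - v) * d)).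
  rewrite !Cmod_mult, !Cmod_R in *.
  rewrite (Rabs_pos_eq s), (Rabs_pos_eq u) in * by lra.
  assert (Hp := Cmod_ge_0 p). assert (Hd := Cmod_ge_0 d).
  assert (Rabs (x - u) * Cmod p <= h * Cmod p) by (apply Rmult_le_compat_r; lra).
  assert (Rabs (x - u) * s <= h * 1) by (apply Rmult_le_compat; auto using Rabs_pos; lra).
  assert (u * Rabs (s - v) <= 1 * h) by (apply Rmult_le_compat; auto using Rabs_pos; lra).
  assert (Rabs (x - u) * s * Cmod d <= h * Cmod d) by (apply Rmult_le_compat_r; lra).
  assert (u * Rabs (s - v) * Cmod d <= h * Cmod d) by (apply Rmult_le_compat_r; lra).
  assert (0 <= h) by (eapply Rle_trans; [apply Rabs_pos|eassumption]).
  assert (0 <= h * Cmod p) by (apply Rmult_le_pos; lra).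
  lra.
Qed.

Lemma cell_boundary_le (f : C -> C) (p d : C) (a c h M : R) :
  on_triangle p d (ex_Cderive f) ->
  0 <= a -> 0 <= c -> 0 < h -> a + h <= 1 -> c + h <= 1 -> 0 <= M ->
  (forall x s, a <= x <= a + h -> c <= s <= c + h -> Cmod (f (x * (p + s * d))%C) <= M) ->
  Cmod (cell_boundary f p d a c h) <= 4 * h * M * (Cmod p + Cmod d).
Proof.
  intros Hf Ha Hc Hh Ha1 Hc1 HM Hbound.
  assert (Hp := Cmod_ge_0 p). assert (Hd := Cmod_ge_0 d).
  assert (HX : forall e, c <= e <= c + h ->
    Cmod (line_int f 0 (p + RtoC e * d)%C a (a + h)) <= h * M * (Cmod p + Cmod d)).
  { intros e He. eapply Rle_trans; [apply (line_int_le_const _ _ _ _ _ M)|].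
    - lra.
    - apply on_triangle_ray; auto; lra.
    - intros x Hx. rewrite Rmin_left, Rmax_right in Hx by lra.
      replace (0 + x * (p + e * d))%C with (x * (p + e * d))%C by ring. apply Hbound; lra.
    - replace (a + h - a) with h by ring. rewrite <- Rmult_assoc.
      apply Rmult_le_compat_l; [nra|].
      eapply Rle_trans; [apply Cmod_triangle|].
      rewrite Cmod_mult, Cmod_R, Rabs_pos_eq by lra. nra. }
  assert (HV : forall b, a <= b <= a + h ->
    Cmod (line_int f (RtoC b * p)%C (RtoC b * d)%C c (c + h)) <= h * M * (Cmod p + Cmod d)).
  { intros b Hb. eapply Rle_trans; [apply (line_int_le_const _ _ _ _ _ M)|].
    - lra.
    - apply on_triangle_transversal; auto; lra.
    - intros s Hs. rewrite Rmin_left, Rmax_right in Hs by lra.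
      replace (b * p + s * (b * d))%C with (b * (p + s * d))%C by ring. apply Hbound; lra.
    - replace (c + h - c) with h by ring. rewrite <- Rmult_assoc.
      apply Rmult_le_compat_l; [nra|].
      rewrite Cmod_mult, Cmod_R, Rabs_pos_eq by lra. nra. }
  unfold cell_boundary, Cminus.
  assert (X1 := HX c ltac:(lra)). assert (X2 := HX (c + h) ltac:(lra)).
  assert (V1 := HV a ltac:(lra)). assert (V2 := HV (a + h) ltac:(lra)).
  eapply Rle_trans; [apply Cmod_triangle|]. rewrite Cmod_opp.
  eapply Rle_trans; [apply Rplus_le_compat_r, Cmod_triangle|]. rewrite Cmod_opp.
  eapply Rle_trans; [apply Rplus_le_compat_r, Rplus_le_compat_r, Cmod_triangle|].
  lra.
Qed.

(** The side of the unit square on which [x = 0] is collapsed to the vertex [0], and the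
    three other sides become the sides of the triangle.  Near each point [f] is affine up to
    a remainder, so the integrals around small cells are [o (h^2)]. *)
Lemma Cauchy_triangle (f : C -> C) (p d : C) :
  on_triangle p d (ex_Cderive f) ->
  (line_int f 0 p 0 1 + line_int f p d 0 1)%C = line_int f 0 (p + d) 0 1.
Proof.
  intros Hf.
  assert (H0 : cell_boundary f p d 0 0 1 = 0).
  { apply (square_additive_vanishes (cell_boundary f p d)).
    - intros a c k; intros. now apply cell_boundary_additive.
    - intros u v eps Hu Hv Heps.
      set (z0 := (u * (p + v * d))%C).
      destruct (Hf u v Hu Hv) as [l Hl]. fold z0 in Hl.
      set (L := Cmod p + Cmod d + 1).
      assert (Hp := Cmod_ge_0 p). assert (Hd := Cmod_ge_0 d).
      assert (HL : 0 < L) by (unfold L; lra).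
      (* Four edges of length at most h L, with a remainder of at most e (2 h L) on them,
         give 8 e L^2 h^2. *)
      set (e := eps / (8 * L ^ 2)).
      assert (He : 0 < e) by (apply Rdiv_lt_0_compat; [lra|nra]).
      destruct (proj1 (is_Cderive_iff _ _ _) Hl e He) as [r [Hr Hlin]].
      exists (r / (2 * L)). split; [apply Rdiv_lt_0_compat; lra|].
      intros a c h Ha Hah Hc Hch Hh.
      set (g := fun z : C => (f z0 + (z - z0) * l)%C).
      set (G := fun z : C => ((f z0 + - (z0 * l)) * z + l / 2 * (z * z))%C).
      assert (HG : forall z, is_Cderive G z (g z)).
      { intros z. unfold G, g. eapply is_Cderive_eq.
        - apply is_Cderive_plus.
          + apply is_Cderive_mult; [apply is_Cderive_const|apply is_Cderive_id].
          + apply is_Cderive_mult; [apply is_Cderive_const|].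
            apply is_Cderive_mult; apply is_Cderive_id.
        - cbn beta. field. }
      assert (Hg : forall z, ex_Cderive g z).
      { intros z. apply ex_Cderive_plus; [apply ex_Cderive_const|].
        apply ex_Cderive_mult; [|apply ex_Cderive_const].
        apply ex_Cderive_plus; [apply ex_Cderive_id|apply ex_Cderive_const]. }
      assert (Hg' : on_triangle p d (ex_Cderive g)) by (intros x s _ _; apply Hg).
      replace (cell_boundary f p d a c h)
        with (cell_boundary (fun z => f z - g z)%C p d a c h).
      2: { rewrite cell_boundary_minus by (auto; lra).
           rewrite (cell_boundary_FTC G g) by assumption. ring. }
      assert (Hd2 : 2 * h * L < r).
      { destruct Hh as [_ Hh]. apply Rlt_div_r in Hh; lra. }
      eapply Rle_trans; [apply (cell_boundary_le _ p d a c h (e * (2 * h * L)))|].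
      + intros x s Hx Hs. apply ex_Cderive_plus; [now apply Hf|].
        apply (ex_Cderive_ext (fun z => - (1) * g z)%C); [intros; ring|].
        apply ex_Cderive_mult; [apply ex_Cderive_const|apply Hg].
      + lra.
      + lra.
      + lra.
      + lra.
      + lra.
      + assert (0 <= h * L) by nra. nra.
      + intros x s Hx Hs.
        assert (Hdist : Cmod (x * (p + s * d) - z0) <= 2 * h * L).
        { eapply Rle_trans; [apply (Cmod_chart_dist p d x s u v h); try lra|].
          - apply Rabs_le; lra.
          - apply Rabs_le; lra.
          - apply Rmult_le_compat_l; [lra|unfold L; lra]. }
        replace (f (x * (p + s * d)) - g (x * (p + s * d)))%C
          with (f (x * (p + s * d)) - f z0 - (x * (p + s * d) - z0) * l)%C
          by (unfold g; ring).
        eapply Rle_trans; [apply Hlin; lra|].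
        apply Rmult_le_compat_l; lra.
      + replace (eps * h ^ 2) with (4 * h * (e * (2 * h * L)) * L)
          by (unfold e; field; lra).
        apply Rmult_le_compat_l; [|unfold L; lra].
        assert (0 <= h * L) by nra. assert (0 <= e * (2 * h * L)) by nra. nra. }
  unfold cell_boundary in H0. rewrite !Rplus_0_l in H0.
  assert (Hleft : line_int f (0 * p)%C (0 * d)%C 0 1 = 0).
  { apply Cmod_eq_0, Rle_antisym; [|apply Cmod_ge_0].
    eapply Rle_trans; [apply (line_int_le_const _ _ _ _ _ (Cmod (f 0)))|].
    - lra.
    - apply on_triangle_transversal; auto; lra.
    - intros s _. apply Req_le; do 2 f_equal. ring.
    - rewrite Cmod_mult, Cmod_0. lra. }
  rewrite Hleft in H0.
  replace (p + 0 * d)%C with p in H0 by ring.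
  replace (1 * p)%C with p in H0 by ring.
  replace (1 * d)%C with d in H0 by ring.
  assert (E : forall x y z : C, (x + y - z - 0)%C = 0 -> (x + y)%C = z).
  { intros x y z E. replace z with (x + y - (x + y - z - 0))%C by ring. rewrite E. ring. }
  now apply E.
Qed.

(** * The error function *)

Lemma entire_on_triangle (f : C -> C) (p d : C) :
  (forall z, ex_Cderive f z) -> on_triangle p d (ex_Cderive f).
Proof. intros H x s _ _. apply H. Qed.

Lemma entire_on_line (f : C -> C) (u v : C) (a b : R) :
  (forall z, ex_Cderive f z) -> on_line (ex_Cderive f) u v a b.
Proof. intros H s _. apply H. Qed.

Lemma ex_Cderive_close (f : C -> C) (z : C) : ex_Cderive f z ->
  forall eps, 0 < eps -> exists d, 0 < d /\
    forall w, Cmod (w - z) < d -> Cmod (f w - f z) <= eps.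
Proof.
  intros [l Hl] eps Heps.
  destruct (proj1 (is_Cderive_iff _ _ _) Hl 1 Rlt_0_1) as [d [Hd H]].
  assert (Hl0 := Cmod_ge_0 l).
  exists (Rmin d (eps / (1 + Cmod l))). split.
  { apply Rmin_pos; [assumption|apply Rdiv_lt_0_compat; lra]. }
  intros w Hw.
  assert (Hw1 := Rlt_le_trans _ _ _ Hw (Rmin_l _ _)).
  assert (Hw2 := Rlt_le_trans _ _ _ Hw (Rmin_r _ _)).
  apply Rlt_div_r in Hw2; [|lra].
  replace (f w - f z)%C with ((f w - f z - (w - z) * l) + (w - z) * l)%C by ring.
  eapply Rle_trans; [apply Cmod_triangle|].
  rewrite Cmod_mult. specialize (H w Hw1). lra.
Qed.

(** By Cauchy's theorem the increment of the primitive from [z] to [w] is the integral over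
    the segment from [z] to [w]. *)
Lemma is_Cderive_primitive (f : C -> C) (z : C) :
  (forall z, ex_Cderive f z) ->
  is_Cderive (fun w => line_int f 0 w 0 1) z (f z).
Proof.
  intros Hf. apply is_Cderive_iff. intros eps Heps.
  destruct (ex_Cderive_close f z (Hf z) eps Heps) as [d [Hd H]].
  exists d; split; [assumption|]. intros w Hw.
  assert (HC := Cauchy_triangle f z (w - z) (entire_on_triangle _ _ _ Hf)).
  replace (z + (w - z))%C with w in HC by ring. rewrite <- HC.
  assert (Hc : line_int (fun _ => f z) z (w - z) 0 1 = ((w - z) * f z)%C).
  { rewrite (line_int_FTC (fun y => f z * y)%C).
    - ring.
    - intros s _. eapply is_Cderive_eq.
      + apply is_Cderive_mult; [apply is_Cderive_const|apply is_Cderive_id].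
      + cbn beta; ring.
    - apply entire_on_line; intros; apply ex_Cderive_const. }
  rewrite <- Hc.
  replace (line_int f 0 z 0 1 + line_int f z (w - z) 0 1 - line_int f 0 z 0 1
           - line_int (fun _ => f z) z (w - z) 0 1)%C
    with (line_int f z (w - z) 0 1 - line_int (fun _ => f z) z (w - z) 0 1)%C by ring.
  rewrite <- line_int_minus.
  - eapply Rle_trans; [apply (line_int_le_const _ _ _ _ _ eps)|].
    + lra.
    + apply entire_on_line. intros y. apply ex_Cderive_plus; [apply Hf|apply ex_Cderive_const].
    + intros s Hs. rewrite Rmin_left, Rmax_right in Hs by lra. apply H.
      replace (z + s * (w - z) - z)%C with (s * (w - z))%C by ring.
      rewrite Cmod_mult, Cmod_R, Rabs_pos_eq by lra.
      assert (H0 := Cmod_ge_0 (w - z)). nra.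
    + apply Req_le; ring.
  - now apply entire_on_line.
  - apply entire_on_line; intros; apply ex_Cderive_const.
Qed.

Definition Cgauss (z : C) : C := Cexp (- z ^ 2).

Lemma ex_Cderive_Cgauss (z : C) : ex_Cderive Cgauss z.
Proof.
  apply (ex_Cderive_comp Cexp (fun z => - z ^ 2)%C).
  - eexists; apply is_Cderive_Cexp.
  - apply (ex_Cderive_ext (fun w => - (1) * (w * w))%C); [intros; simpl; ring|].
    apply ex_Cderive_mult; [apply ex_Cderive_const|].
    apply ex_Cderive_mult; apply ex_Cderive_id.
Qed.

Lemma Cmod_Cgauss (z : C) : Cmod (Cgauss z) = exp (snd z ^ 2 - fst z ^ 2).
Proof.
  unfold Cgauss. rewrite Cmod_Cexp. f_equal. destruct z.
  unfold Re, Cpow, Copp, Cmult, RtoC; cbn. ring.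
Qed.

Lemma Cerf_line_int (z : C) : Cerf z = (RtoC (2 / sqrt PI) * line_int Cgauss 0 z 0 1)%C.
Proof.
  unfold Cerf. f_equal.
  - rewrite RtoC_div; [reflexivity|]. apply Rgt_not_eq, sqrt_lt_R0, PI_RGT_0.
  - apply (RInt_ext (V := C_R_CompleteNormedModule)). intros s _.
    unfold Cgauss. now rewrite Cplus_0_l.
Qed.

(** The integral that defines the error function does not depend on the path, so increments
    of [Cerf] can be estimated along horizontal and vertical segments. *)
Lemma Cerf_increment (z w : C) :
  Cerf w = (Cerf z + RtoC (2 / sqrt PI) * line_int Cgauss z (w - z) 0 1)%C.
Proof.
  assert (HC := Cauchy_triangle Cgauss z (w - z) (entire_on_triangle _ _ _ ex_Cderive_Cgauss)).
  replace (z + (w - z))%C with w in HC by ring.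
  rewrite !Cerf_line_int, <- HC. ring.
Qed.

Lemma ex_Cderive_Cerf (z : C) : ex_Cderive Cerf z.
Proof.
  apply (ex_Cderive_ext (fun z => RtoC (2 / sqrt PI) * line_int Cgauss 0 z 0 1)%C).
  { intros; now rewrite Cerf_line_int. }
  apply ex_Cderive_mult; [apply ex_Cderive_const|].
  eexists; apply is_Cderive_primitive, ex_Cderive_Cgauss.
Qed.

Lemma ex_Cderive_Lambda (z : C) : ex_Cderive Lambda z.
Proof.
  apply (ex_Cderive_ext (fun z => Cexp (z * z) * (1 + - (1) * Cerf z))%C).
  { intros w. unfold Lambda. f_equal; [f_equal; simpl; ring|ring]. }
  apply ex_Cderive_mult.
  - apply (ex_Cderive_comp Cexp (fun z => z * z)%C); [eexists; apply is_Cderive_Cexp|].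
    apply ex_Cderive_mult; apply ex_Cderive_id.
  - apply ex_Cderive_plus; [apply ex_Cderive_const|].
    apply ex_Cderive_mult; [apply ex_Cderive_const|apply ex_Cderive_Cerf].
Qed.

(** ** The Gaussian integral *)

Lemma exp_mono (x y : R) : x <= y -> exp x <= exp y.
Proof. intros [H| ->]; [now apply Rlt_le, exp_increasing|apply Rle_refl]. Qed.

Definition gauss_int (u : R) : R := RInt (fun s => exp (- s ^ 2)) 0 u.

(** The companion of [gauss_int u ^ 2] whose derivative is the opposite of that of the square. *)
Definition gauss_aux (u : R) : R :=
  RInt (fun s => exp (- u ^ 2 * (1 + s ^ 2)) / (1 + s ^ 2)) 0 1.

Lemma continuous_of_derive (f : R -> R) (x : R) : ex_derive f x -> continuous f x.
Proof. exact (ex_derive_continuous (K := R_AbsRing) (V := R_NormedModule) f x). Qed.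

Lemma ex_RInt_of_derive (f : R -> R) (a b : R) :
  (forall x, ex_derive f x) -> ex_RInt f a b.
Proof.
  intros H. apply (ex_RInt_continuous (V := R_CompleteNormedModule)).
  intros x _. apply continuous_of_derive, H.
Qed.

Lemma is_derive_gauss_int (u : R) : is_derive gauss_int u (exp (- u ^ 2)).
Proof.
  apply (is_derive_RInt (V := R_NormedModule) (fun s => exp (- s ^ 2)) gauss_int 0).
  - apply filter_forall. intros x. apply (RInt_correct (V := R_CompleteNormedModule)).
    apply ex_RInt_of_derive. intros y; auto_derive; trivial.
  - apply continuous_of_derive. auto_derive; trivial.
Qed.

Lemma gauss_int_scaled (u : R) :
  RInt (fun s => u * exp (- (u * s) ^ 2)) 0 1 = gauss_int u.
Proof.
  unfold gauss_int.
  assert (H := RInt_comp_lin (V := R_CompleteNormedModule) (fun s => exp (- s ^ 2)) u 0 0 1).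
  rewrite !Rplus_0_r, Rmult_0_r, Rmult_1_r in H. rewrite <- H.
  - apply RInt_ext. intros s _. rewrite Rplus_0_r. reflexivity.
  - apply ex_RInt_of_derive. intros y; auto_derive; trivial.
Qed.

Lemma is_derive_gauss_aux (u : R) :
  is_derive gauss_aux u (- 2 * exp (- u ^ 2) * gauss_int u).
Proof.
  assert (Hpos : forall s : R, 1 + s ^ 2 <> 0) by (intros s; nra).
  assert (HD : forall x s : R, is_derive
    (fun u => exp (- u ^ 2 * (1 + s ^ 2)) / (1 + s ^ 2)) x
    (- 2 * x * exp (- x ^ 2 * (1 + s ^ 2)))).
  { intros x s. auto_derive; [trivial|]. simpl. field. nra. }
  assert (H := is_derive_RInt_param
    (fun u s => exp (- u ^ 2 * (1 + s ^ 2)) / (1 + s ^ 2)) 0 1 u).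
  replace (- 2 * exp (- u ^ 2) * gauss_int u)
    with (RInt (fun t => Derive (fun u => exp (- u ^ 2 * (1 + t ^ 2)) / (1 + t ^ 2)) u) 0 1).
  - apply H; clear H.
    + apply filter_forall. intros x s _. eexists; apply HD.
    + intros t _.
      apply (continuity_2d_pt_ext (fun x s => - 2 * x * exp (- (x * x) * (1 + s * s)))).
      { intros x y. transitivity (- 2 * x * exp (- x ^ 2 * (1 + y ^ 2))).
        - do 2 f_equal. ring.
        - symmetry. exact (is_derive_unique _ _ _ (HD x y)). }
      apply continuity_2d_pt_mult.
      * apply continuity_2d_pt_mult; [apply continuity_2d_pt_const|apply continuity_2d_pt_id1].
      * apply (continuity_1d_2d_pt_comp exp).
        { apply derivable_continuous_pt, derivable_pt_exp. }
        apply continuity_2d_pt_mult.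
        -- apply continuity_2d_pt_opp, continuity_2d_pt_mult; apply continuity_2d_pt_id1.
        -- apply continuity_2d_pt_plus; [apply continuity_2d_pt_const|].
           apply continuity_2d_pt_mult; apply continuity_2d_pt_id2.
    + apply filter_forall. intros x. apply ex_RInt_of_derive.
      intros s; auto_derive. repeat split. apply Hpos.
  - rewrite <- gauss_int_scaled.
    rewrite <- (RInt_scal (V := R_CompleteNormedModule)).
    + apply RInt_ext. intros s _. etransitivity; [exact (is_derive_unique _ _ _ (HD u s))|].
      change (scal (-2 * exp (- u ^ 2)) (u * exp (- (u * s) ^ 2)))
        with (-2 * exp (- u ^ 2) * (u * exp (- (u * s) ^ 2))).
      replace (- u ^ 2 * (1 + s ^ 2)) with (- u ^ 2 + - (u * s) ^ 2) by ring.
      rewrite exp_plus. eq_in R. ring.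
    + apply ex_RInt_of_derive. intros s; auto_derive; trivial.
Qed.

Lemma gauss_aux_0 : gauss_aux 0 = PI / 4.
Proof.
  rewrite <- atan_1. unfold gauss_aux.
  apply (is_RInt_unique (V := R_CompleteNormedModule)).
  replace (atan 1) with (minus (atan 1) (atan 0))
    by (rewrite atan_0; unfold minus, plus, opp; simpl; ring).
  apply (is_RInt_derive (V := R_CompleteNormedModule) atan).
  - intros x _. auto_derive; [trivial|].
    replace (- 0 ^ 2 * (1 + x ^ 2)) with 0 by ring. rewrite exp_0. field. nra.
  - intros x _. apply continuous_of_derive. auto_derive. repeat split. nra.
Qed.

(** The classical evaluation of the Gaussian integral: the left-hand side has derivative zero
    and takes the value [PI / 4] at [0].  As [gauss_aux u] tends to [0], the square of the
    integral tends to [PI / 4]. *)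
Lemma gauss_int_sqr (u : R) : 0 <= u -> gauss_int u ^ 2 + gauss_aux u = PI / 4.
Proof.
  intros Hu. rewrite <- gauss_aux_0.
  replace (gauss_aux 0) with (gauss_int 0 ^ 2 + gauss_aux 0)
    by (unfold gauss_int; rewrite RInt_point; unfold zero; simpl; ring).
  destruct (Rle_lt_or_eq_dec 0 u Hu) as [Hu'|<-]; [|reflexivity]. symmetry.
  apply (eq_is_derive (V := R_NormedModule) (fun u => gauss_int u ^ 2 + gauss_aux u)); [|assumption].
  intros x _.
  assert (HD := is_derive_plus (K := R_AbsRing) (V := R_NormedModule) _ _ x _ _
    (is_derive_pow gauss_int 2 x _ (is_derive_gauss_int x)) (is_derive_gauss_aux x)).
  eapply (eq_ind _ (fun l => is_derive _ x l)); [exact HD|].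
  unfold plus, zero; simpl. eq_in R. ring.
Qed.

Lemma gauss_aux_bounds (u : R) : 0 <= gauss_aux u <= exp (- u ^ 2).
Proof.
  assert (Hex : ex_RInt (fun s => exp (- u ^ 2 * (1 + s ^ 2)) / (1 + s ^ 2)) 0 1).
  { apply ex_RInt_of_derive. intros s; auto_derive. repeat split. nra. }
  unfold gauss_aux. split.
  - apply RInt_ge_0; [lra|assumption|]. intros s _.
    apply Rlt_le, Rdiv_lt_0_compat; [apply exp_pos|nra].
  - replace (exp (- u ^ 2)) with (RInt (fun _ => exp (- u ^ 2)) 0 1)
      by (rewrite RInt_const; unfold scal; simpl; unfold mult; simpl; ring).
    apply RInt_le; [lra|assumption|apply ex_RInt_const|].
    intros s _. apply Rle_div_l; [nra|].
    rewrite <- (Rmult_1_r (exp (- u ^ 2 * _))).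
    apply Rmult_le_compat; [apply Rlt_le, exp_pos|lra| |nra].
    apply exp_mono. nra.
Qed.

Lemma gauss_int_ge_0 (u : R) : 0 <= u -> 0 <= gauss_int u.
Proof.
  intros Hu. apply RInt_ge_0; [assumption| |].
  - apply ex_RInt_of_derive. intros y; auto_derive; trivial.
  - intros s _. apply Rlt_le, exp_pos.
Qed.

Lemma CRInt_RtoC (f : R -> R) (a b : R) :
  ex_RInt f a b -> CRInt (fun s => RtoC (f s)) a b = RtoC (RInt f a b).
Proof.
  intros Hf. apply (is_RInt_unique (V := C_R_CompleteNormedModule)).
  apply (is_RInt_fct_extend_pair (U := R_NormedModule) (V := R_NormedModule)); cbn [fst snd RtoC].
  - apply (RInt_correct (V := R_CompleteNormedModule)), Hf.
  - assert (H := is_RInt_const (V := R_NormedModule) a b 0).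
    replace (scal (b - a) (0 : R_NormedModule)) with 0 in H
      by (unfold scal; simpl; unfold mult; simpl; ring).
    exact H.
Qed.

Lemma Cerf_RtoC (u : R) : Cerf u = RtoC (2 / sqrt PI * gauss_int u).
Proof.
  rewrite Cerf_line_int, RtoC_mult. f_equal.
  rewrite <- gauss_int_scaled, <- CRInt_RtoC.
  - apply (RInt_ext (V := C_R_CompleteNormedModule)). intros s _.
    unfold Cgauss.
    replace (- (0 + s * u) ^ 2)%C with (RtoC (- (u * s) ^ 2))
      by (rewrite RtoC_opp, RtoC_pow, RtoC_mult; f_equal; f_equal; ring).
    rewrite Cexp_RtoC, RtoC_mult.
    eq_in C. ring.
  - apply ex_RInt_of_derive. intros s; auto_derive; trivial.
Qed.

(** With [x = erf u], [gauss_int_sqr] says [(1 - x)(1 + x) = 4 / PI * gauss_aux u], and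
    [1 + x >= 1]. *)
Lemma erfc_le (u : R) : 0 <= u -> Cmod (1 - Cerf u) <= 2 * exp (- u ^ 2).
Proof.
  intros Hu. rewrite Cerf_RtoC, <- RtoC_minus, Cmod_R.
  assert (HPI := PI_RGT_0). assert (H3 := PI2_3_2).
  assert (Hs : 0 < sqrt PI) by (now apply sqrt_lt_R0).
  assert (Hss : sqrt PI * sqrt PI = PI) by (apply sqrt_sqrt; lra).
  set (x := 2 / sqrt PI * gauss_int u).
  assert (Hx0 : 0 <= x).
  { apply Rmult_le_pos; [apply Rlt_le, Rdiv_lt_0_compat; lra|now apply gauss_int_ge_0]. }
  assert (Hx : 1 - x * x = 4 / PI * gauss_aux u).
  { assert (E := gauss_int_sqr u Hu).
    replace (gauss_aux u) with (PI / 4 - gauss_int u ^ 2) by lra.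
    unfold x.
    replace (2 / sqrt PI * gauss_int u * (2 / sqrt PI * gauss_int u))
      with (4 * gauss_int u ^ 2 / (sqrt PI * sqrt PI)) by (field; lra).
    rewrite Hss. field. lra. }
  destruct (gauss_aux_bounds u) as [B0 B1].
  assert (H4 : 4 / PI <= 2) by (apply Rle_div_l; lra).
  assert (H4' : 0 <= 4 / PI) by (apply Rlt_le, Rdiv_lt_0_compat; lra).
  assert (0 <= 4 / PI * gauss_aux u <= 2 * exp (- u ^ 2)).
  { split; [now apply Rmult_le_pos|]. now apply Rmult_le_compat. }
  assert (x <= 1) by nra.
  rewrite Rabs_pos_eq by lra. nra.
Qed.

Lemma two_div_sqrt_PI : 0 < 2 / sqrt PI <= 2.
Proof.
  assert (H3 := PI2_3_2).
  assert (1 <= sqrt PI) by (rewrite <- sqrt_1; apply sqrt_le_1_alt; lra).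
  split; [apply Rdiv_lt_0_compat; lra|apply Rle_div_l; lra].
Qed.

Lemma RInt_exp_decay (k : R) : RInt (fun s => exp (- (k * s)) * k) 0 1 = 1 - exp (- k).
Proof.
  apply (is_RInt_unique (V := R_CompleteNormedModule)).
  replace (1 - exp (- k)) with (minus (- exp (- (k * 1))) (- exp (- (k * 0)))).
  2: { rewrite Rmult_1_r, Rmult_0_r, Ropp_0, exp_0. unfold minus, plus, opp; simpl; ring. }
  apply (is_RInt_derive (V := R_CompleteNormedModule) (fun s => - exp (- (k * s)))).
  - intros s _. auto_derive; [trivial|ring].
  - intros s _. apply continuous_of_derive. auto_derive; trivial.
Qed.

(** Along the segment the modulus of the integrand is
    [exp (Im w^2 - Re w^2) * exp (- 2 v Re w - v^2)] with [0 <= v <= U], and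
    [- 2 v Re w - v^2 <= 2 c v - v^2 <= (2 c + 1)^2 / 4 - v]. *)
Lemma Cerf_horizontal (w : C) (c U : R) :
  0 <= U -> - c <= Re w ->
  Cmod (Cerf (w + U) - Cerf w) <=
    2 * exp ((2 * c + 1) ^ 2 / 4) * exp (snd w ^ 2 - fst w ^ 2).
Proof.
  intros HU Hc. change (Re w) with (fst w) in Hc.
  rewrite (Cerf_increment w (w + U)).
  replace (w + U - w)%C with (RtoC U) by ring.
  match goal with |- Cmod (?a + ?b - ?a) <= _ => replace (a + b - a)%C with b by ring end.
  assert (H2 := two_div_sqrt_PI).
  rewrite Cmod_mult, Cmod_R, Rabs_pos_eq, Rmult_assoc by lra.
  apply Rmult_le_compat; [lra|apply Cmod_ge_0|lra|].
  set (K := exp ((2 * c + 1) ^ 2 / 4) * exp (snd w ^ 2 - fst w ^ 2)).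
  assert (HK : 0 < K) by (apply Rmult_lt_0_compat; apply exp_pos).
  eapply Rle_trans; [apply (Cmod_RInt_le _ (fun s => K * (exp (- (U * s)) * U)))|].
  - lra.
  - apply ex_line_int, entire_on_line, ex_Cderive_Cgauss.
  - apply ex_RInt_of_derive. intros s; auto_derive; trivial.
  - intros s Hs. rewrite Cmod_mult, Cmod_R, (Rabs_pos_eq U), <- Rmult_assoc by assumption.
    apply Rmult_le_compat_r; [assumption|].
    rewrite Cmod_Cgauss. unfold K. rewrite <- !exp_plus. apply exp_mono.
    destruct w as [a b]. unfold Cplus, Cmult, RtoC; cbn [fst snd] in *.
    assert (0 <= s * U) by nra.
    assert (0 <= (a + c) * (s * U)) by nra.
    assert (0 <= (s * U - (2 * c + 1) / 2) ^ 2) by apply pow2_ge_0.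
    nra.
  - rewrite (RInt_scal (V := R_CompleteNormedModule) (fun s => exp (- (U * s)) * U)).
    + rewrite RInt_exp_decay. assert (0 < exp (- U)) by apply exp_pos.
      change (scal K (1 - exp (- U))) with (K * (1 - exp (- U))). nra.
    + apply ex_RInt_of_derive. intros s; auto_derive; trivial.
Qed.

Lemma Cerf_vertical (u b : R) :
  Cmod (Cerf (u, b) - Cerf u) <= 2 * (exp (b ^ 2) * Rabs b) * exp (- u ^ 2).
Proof.
  rewrite (Cerf_increment u (u, b)).
  replace ((u, b) - u)%C with ((0, b) : C)
    by (unfold Cminus, Cplus, Copp, RtoC; cbn; f_equal; ring).
  match goal with |- Cmod (?a + ?b - ?a) <= _ => replace (a + b - a)%C with b by ring end.
  assert (H2 := two_div_sqrt_PI).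
  rewrite Cmod_mult, Cmod_R, Rabs_pos_eq, Rmult_assoc by lra.
  apply Rmult_le_compat; [lra|apply Cmod_ge_0|lra|].
  eapply Rle_trans; [apply (line_int_le_const _ _ _ _ _ (exp (b ^ 2 - u ^ 2)))|].
  - lra.
  - apply entire_on_line, ex_Cderive_Cgauss.
  - intros s Hs. rewrite Rmin_left, Rmax_right in Hs by lra.
    rewrite Cmod_Cgauss. apply exp_mono.
    unfold Cplus, Cmult, RtoC; cbn [fst snd].
    assert (0 <= (1 - s * s) * (b * b)) by (apply Rmult_le_pos; nra). lra.
  - replace (b ^ 2 - u ^ 2) with (b ^ 2 + - u ^ 2) by ring. rewrite exp_plus.
    replace (Cmod (0, b)) with (Rabs b).
    + apply Req_le; ring.
    + replace ((0, b) : C) with (Ci * b)%C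
        by (unfold Ci, Cmult, RtoC; cbn; f_equal; ring).
      rewrite Cmod_mult, Cmod_Ci, Cmod_R. ring.
Qed.

(** Go from [w] to [+ oo] horizontally: [1 - erf w] is the increment of [erf] along a long
    horizontal segment, bounded uniformly by [Cerf_horizontal] after multiplication by
    [exp (w^2)], plus the value of [1 - erf] far to the right, which is compared with its
    value on the real axis and vanishes in the limit. *)
Lemma Lambda_bounded (c : R) (w : C) :
  - c <= Re w -> Cmod (Lambda w) <= 2 * exp ((2 * c + 1) ^ 2 / 4).
Proof.
  intros Hc. apply le_epsilon. intros eps Heps.
  destruct w as [a b]. 
  set (K := exp (a ^ 2 - b ^ 2) * (2 + 2 * (exp (b ^ 2) * Rabs b))).
  assert (HK : 0 < K).
  { apply Rmult_lt_0_compat; [apply exp_pos|].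
    assert (0 <= exp (b ^ 2) * Rabs b) by (apply Rmult_le_pos; [apply Rlt_le, exp_pos|apply Rabs_pos]). lra. }
  (* At the abscissa v the contribution K exp (- v^2) of the far end is below eps. *)
  set (v := Rabs a + K / eps).
  assert (HKe : 0 < K / eps) by (now apply Rdiv_lt_0_compat).
  assert (Ha0 := Rabs_pos a). assert (Ha1 := Rle_abs a).
  set (U := v - a).
  assert (HU : 0 <= U) by (unfold U, v; lra).
  assert (Hv : 0 < v) by (unfold v; lra).
  assert (Hsmall : K * exp (- v ^ 2) <= eps).
  { rewrite exp_Ropp. apply Rle_div_l; [apply exp_pos|].
    assert (1 + v ^ 2 <= exp (v ^ 2)) by (apply Rlt_le, exp_ineq1; nra).
    assert (v <= exp (v ^ 2)) by nra.
    assert (K = eps * (K / eps)) by (field; lra).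
    assert (K / eps <= v) by (unfold v; lra). nra. }
  assert (H1 := erfc_le v (Rlt_le _ _ Hv)).
  assert (H2 := Cerf_vertical v b).
  assert (H3 := Cerf_horizontal (a, b) c U HU Hc). cbn [fst snd] in H3.
  replace ((a, b) + U)%C with ((v, b) : C) in H3
    by (unfold Cplus, RtoC, U; cbn; f_equal; ring).
  unfold Lambda. rewrite Cmod_mult, Cmod_Cexp.
  replace (Re ((a, b) ^ 2)) with (a ^ 2 - b ^ 2)
    by (unfold Re, Cpow, Cmult, RtoC; cbn; ring).
  replace (1 - Cerf (a, b))%C
    with ((1 - Cerf v) + (- (Cerf (v, b) - Cerf v) + (Cerf (v, b) - Cerf (a, b))))%C by ring.
  assert (T1 := Cmod_triangle (1 - Cerf v) (- (Cerf (v, b) - Cerf v) + (Cerf (v, b) - Cerf (a, b)))).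
  assert (T2 := Cmod_triangle (- (Cerf (v, b) - Cerf v)) (Cerf (v, b) - Cerf (a, b))).
  rewrite Cmod_opp in T2.
  set (Q := exp (a ^ 2 - b ^ 2)) in *.
  assert (HQ : 0 < Q) by apply exp_pos.
  assert (HQ' : Q * exp (b ^ 2 - a ^ 2) = 1).
  { unfold Q. rewrite <- exp_plus. replace (a ^ 2 - b ^ 2 + (b ^ 2 - a ^ 2)) with 0 by ring. apply exp_0. }
  eapply Rle_trans.
  { apply Rmult_le_compat_l; [lra|]. eapply Rle_trans; [apply T1|].
    eapply Rle_trans; [apply Rplus_le_compat_l, T2|].
    apply Rplus_le_compat; [apply H1|]. apply Rplus_le_compat; [apply H2|apply H3]. }
  unfold K in Hsmall.
  replace (Q * (2 * exp (- v ^ 2) + (2 * (exp (b ^ 2) * Rabs b) * exp (- v ^ 2) +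
     2 * exp ((2 * c + 1) ^ 2 / 4) * exp (b ^ 2 - a ^ 2))))
    with (Q * (2 + 2 * (exp (b ^ 2) * Rabs b)) * exp (- v ^ 2) +
     2 * exp ((2 * c + 1) ^ 2 / 4) * (Q * exp (b ^ 2 - a ^ 2))) by ring.
  rewrite HQ'. lra.
Qed.

(** * Improper integrals and rotation of the half-line *)

Definition tends_at_infinity (I : R -> C) (l : C) : Prop :=
  forall eps, 0 < eps -> exists R0, forall r, R0 <= r -> Cmod (I r - l) < eps.

Lemma tends_ext_pos (I J : R -> C) (l : C) :
  (forall r, 0 < r -> I r = J r) -> tends_at_infinity I l -> tends_at_infinity J l.
Proof.
  intros HIJ HI eps Heps. destruct (HI eps Heps) as [R0 H].
  exists (Rmax R0 1). intros r Hr.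
  assert (H0 := Rmax_l R0 1). assert (H1 := Rmax_r R0 1).
  rewrite <- HIJ by lra. apply H; lra.
Qed.

Lemma tends_minus (I J : R -> C) (l m : C) :
  tends_at_infinity I l -> tends_at_infinity J m ->
  tends_at_infinity (fun r => I r - J r)%C (l - m)%C.
Proof.
  intros HI HJ eps Heps.
  destruct (HI (eps / 2) ltac:(lra)) as [R0 H0].
  destruct (HJ (eps / 2) ltac:(lra)) as [R1 H1].
  exists (Rmax R0 R1). intros r Hr.
  assert (M0 := Rmax_l R0 R1). assert (M1 := Rmax_r R0 R1).
  specialize (H0 r ltac:(lra)). specialize (H1 r ltac:(lra)).
  replace (I r - J r - (l - m))%C with ((I r - l) + - (J r - m))%C by ring.
  eapply Rle_lt_trans; [apply Cmod_triangle|]. rewrite Cmod_opp. lra.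
Qed.

Lemma Cmod_tends_le (I : R -> C) (l : C) (M : R) :
  tends_at_infinity I l -> (forall r, 0 <= r -> Cmod (I r) <= M) -> Cmod l <= M.
Proof.
  intros HI HM. apply le_epsilon. intros eps Heps.
  destruct (HI eps Heps) as [R0 H].
  assert (H0 := Rmax_l R0 0). assert (H1 := Rmax_r R0 0).
  specialize (H (Rmax R0 0) H0). specialize (HM (Rmax R0 0) H1).
  replace l with (I (Rmax R0 0) + - (I (Rmax R0 0) - l))%C by ring.
  eapply Rle_trans; [apply Cmod_triangle|]. rewrite Cmod_opp. lra.
Qed.

Lemma RInt_exp_le (a b M : R) :
  0 <= M -> RInt (fun s => M * exp (- s)) a b <= M * exp (- a).
Proof.
  intros HM.
  rewrite (is_RInt_unique (V := R_CompleteNormedModule) _ _ _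
    (minus (- (M * exp (- b))) (- (M * exp (- a))))).
  - unfold minus, plus, opp; simpl. assert (H := exp_pos (- b)). nra.
  - apply (is_RInt_derive (V := R_CompleteNormedModule) (fun s => - (M * exp (- s)))).
    + intros s _. auto_derive; [trivial|ring].
    + intros s _. apply continuous_of_derive. auto_derive; trivial.
Qed.

Lemma Cmod_RInt_exp_le (g : R -> C) (a b M : R) :
  a <= b -> 0 <= M -> ex_CRInt g a b ->
  (forall s, a <= s <= b -> Cmod (g s) <= M * exp (- s)) ->
  Cmod (CRInt g a b) <= M * exp (- a).
Proof.
  intros Hab HM Hex Hg.
  eapply Rle_trans; [|apply (RInt_exp_le a b M HM)].
  apply Cmod_RInt_le; [assumption|assumption| |assumption].
  apply ex_RInt_of_derive. intros s; auto_derive; trivial.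
Qed.

Lemma tends_RInt_exp_dominated (g : R -> C) (M : R) :
  0 <= M -> (forall r, 0 <= r -> ex_CRInt g 0 r) ->
  (forall s, 0 <= s -> Cmod (g s) <= M * exp (- s)) ->
  exists l, tends_at_infinity (CRInt g 0) l.
Proof.
  intros HM Hex Hg.
  assert (Htail : forall a b, 0 <= a <= b ->
    Cmod (CRInt g 0 b - CRInt g 0 a) <= M * exp (- a)).
  { intros a b Hab.
    assert (Hexab : ex_CRInt g a b).
    { apply (ex_RInt_Chasles_2 (V := C_R_CompleteNormedModule) g 0 a b Hab), Hex; lra. }
    assert (E : CRInt g 0 b = (CRInt g 0 a + CRInt g a b)%C).
    { symmetry. apply (RInt_Chasles (V := C_R_CompleteNormedModule)); [apply Hex; lra|assumption]. }
    rewrite E. replace (CRInt g 0 a + CRInt g a b - CRInt g 0 a)%C with (CRInt g a b)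
      by (symmetry; eq_in C; ring).
    apply Cmod_RInt_exp_le; try assumption; try lra. intros; apply Hg; lra. }
  destruct (proj1 (filterlim_locally_cauchy (U := C_R_CompleteNormedModule)
    (F := Rbar_locally p_infty) (fun r => CRInt g 0 r))) as [l Hl].
  - intros eps.
    exists (fun r => M / eps < r). split; [exists (M / eps); auto|].
    assert (HMe : 0 <= M / eps) by (apply Rdiv_le_0_compat; [assumption|apply cond_pos]).
    assert (Hsmall : forall u, M / eps < u -> M * exp (- u) < eps).
    { intros u Hu. assert (He := cond_pos eps). apply Rlt_div_l in Hu; [|assumption].
      rewrite exp_Ropp. apply Rlt_div_l; [apply exp_pos|].
      assert (1 + u <= exp u) by (apply exp_ineq1_le). nra. }
    assert (Hdist : forall u v, M / eps < u -> u <= v -> Cmod (CRInt g 0 v - CRInt g 0 u) < eps).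
    { intros u v Hu Huv. eapply Rle_lt_trans; [apply Htail; lra|now apply Hsmall]. }
    intros u v Hu Hv.
    apply (C_NormedModule_mixin_compat1 (CRInt g 0 u) (CRInt g 0 v) eps).
    change (Cmod (CRInt g 0 v - CRInt g 0 u) < eps).
    destruct (Rle_lt_dec u v) as [H|H]; [now apply Hdist|].
    rewrite <- Cmod_opp.
    replace (- (CRInt g 0 v - CRInt g 0 u))%C with (CRInt g 0 u - CRInt g 0 v)%C by (eq_in C; ring).
    apply Hdist; lra.
  - exists l. intros eps Heps.
    assert (H2 : 0 < sqrt 2) by (apply sqrt_lt_R0; lra).
    assert (He : 0 < eps / sqrt 2) by (now apply Rdiv_lt_0_compat).
    destruct (Hl (ball (M := C_R_CompleteNormedModule) l (mkposreal _ He))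
      (ex_intro _ (mkposreal _ He) (fun y Hy => Hy))) as [R0 HR].
    exists (R0 + 1). intros r Hr.
    specialize (HR r ltac:(lra)).
    apply (C_NormedModule_mixin_compat2 l (CRInt g 0 r) (mkposreal _ He)) in HR.
    change (Cmod (CRInt g 0 r - l) < sqrt 2 * (eps / sqrt 2)) in HR.
    replace (sqrt 2 * (eps / sqrt 2)) with eps in HR by (field; lra). exact HR.
Qed.

Lemma line_int_rescale (f : C -> C) (u v : C) (c : R) :
  on_line (ex_Cderive f) u v 0 c ->
  line_int f u (c * v) 0 1 = line_int f u v 0 c.
Proof.
  intros H. unfold line_int.
  assert (E := RInt_comp_lin (V := C_R_CompleteNormedModule) (fun s : R => f (u + s * v) * v)%C c 0 0 1).
  rewrite !Rplus_0_r, Rmult_0_r, Rmult_1_r in E. rewrite <- E by now apply ex_line_int.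
  apply (RInt_ext (V := C_R_CompleteNormedModule)). intros s _.
  rewrite Rplus_0_r.
  assert (Hs : forall z : C, scal (V := C_R_CompleteNormedModule) c z = (c * z)%C).
  { intros [x y]. unfold Cmult, RtoC; cbn [fst snd].
    change ((c * x, c * y) = (c * x - 0 * y, c * y + 0 * x)). f_equal; ring. }
  rewrite Hs, RtoC_mult.
  replace (c * s * v)%C with (s * (c * v))%C by ring.
  eq_in C. ring.
Qed.

(** Cartesian description of the sector of angle [atan k]. *)
Definition on_wedge (k : R) (P : C -> Prop) : Prop :=
  forall X Y : R, 0 <= Y <= k * X -> P (X, Y).

(** Growth like [exp (q Im z)] is allowed near the imaginary axis, but further to the right
    it turns into decay, at a rate that increases linearly with [Re z].  This is the condition
    under which the half-line can be turned. *)
Definition damped (D p q : R) (f : C -> C) (z : C) : Prop :=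
  Cmod (f z) <= D * exp (- ((p * Re z - q) * Im z)).

Section Rotation.

Variables (f : C -> C) (k D p q : R).
Hypothesis Hk : 0 < k.
Hypothesis HD : 0 <= D.
Hypothesis Hp : 0 < p.
Hypothesis Hf : on_wedge k (ex_Cderive f).
Hypothesis Hbound : on_wedge k (damped D p q f).

Lemma on_wedge_ray (P : C -> Prop) (c : R) :
  0 <= c -> on_wedge k P -> on_line P 0 (1, k) 0 c.
Proof.
  intros Hc HP s Hs. rewrite Rmin_left in Hs by lra.
  replace (0 + s * (1%R, k))%C with ((s, (k * s)%R) : C)
    by (unfold Cplus, Cmult, RtoC; cbn; f_equal; ring).
  apply HP. nra.
Qed.

Lemma on_wedge_axis (P : C -> Prop) (c : R) :
  0 <= c -> on_wedge k P -> on_line P 0 1 0 c.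
Proof.
  intros Hc HP s Hs. rewrite Rmin_left in Hs by lra.
  replace (0 + s * 1)%C with ((s, 0) : C)
    by (unfold Cplus, Cmult, RtoC; cbn; f_equal; ring).
  apply HP. nra.
Qed.

Lemma on_wedge_vertical (P : C -> Prop) (r : R) :
  0 <= r -> on_wedge k P -> on_line P (RtoC r) (0%R, (k * r)%R) 0 1.
Proof.
  intros Hr HP s Hs. rewrite Rmin_left, Rmax_right in Hs by lra.
  replace (r + s * (0%R, (k * r)%R))%C with ((r, (s * (k * r))%R) : C)
    by (unfold Cplus, Cmult, RtoC; cbn; f_equal; ring).
  apply HP. assert (0 <= k * r) by nra. nra.
Qed.

Lemma wedge_triangle (r : R) : 0 <= r ->
  (line_int f 0 1 0 r + line_int f r (0%R, (k * r)%R) 0 1)%C = line_int f 0 (1, k) 0 r.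
Proof.
  intros Hr.
  rewrite <- (line_int_rescale f 0 1 r), <- (line_int_rescale f 0 (1, k) r).
  - replace (r * 1)%C with (RtoC r) by ring.
    replace (r * (1%R, k))%C with (r + (0%R, (k * r)%R))%C
      by (unfold Cplus, Cmult, RtoC; cbn; f_equal; ring).
    apply Cauchy_triangle. intros x s Hx Hs.
    replace (x * (r + s * (0%R, (k * r)%R)))%C with (((x * r)%R, (x * s * (k * r))%R) : C)
      by (unfold Cplus, Cmult, RtoC; cbn; f_equal; ring).
    apply Hf. assert (0 <= k * r) by nra. assert (0 <= x * s) by nra.
    assert (0 <= x * (k * r)) by nra. nra.
  - now apply on_wedge_ray.
  - now apply on_wedge_axis.
Qed.

(** On the side above [r] the integrand is at most [D exp (- (p r - q) Y)]. *)
Lemma vertical_edge_le (r : R) : 0 < r -> q < p * r ->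
  Cmod (line_int f r (0%R, (k * r)%R) 0 1) <= D / (p * r - q).
Proof.
  intros Hr Hq. set (m := p * r - q). assert (Hm : 0 < m) by (unfold m; lra).
  assert (HDm : 0 <= D / m) by (apply Rdiv_le_0_compat; lra).
  set (K := m * (k * r)).
  eapply Rle_trans; [apply (Cmod_RInt_le _ (fun s => D / m * (exp (- (K * s)) * K)))|].
  - lra.
  - apply ex_line_int, on_wedge_vertical; [lra|assumption].
  - apply ex_RInt_of_derive. intros s; auto_derive; trivial.
  - intros s Hs. rewrite Cmod_mult.
    assert (E := on_wedge_vertical _ r (Rlt_le _ _ Hr) Hbound s).
    rewrite Rmin_left, Rmax_right in E by lra. specialize (E Hs).
    unfold damped in E.
    replace (Cmod (0%R, (k * r)%R)) with (k * r).
    2: { replace ((0%R, (k * r)%R) : C) with (Ci * RtoC (k * r))%C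
           by (unfold Ci, Cmult, RtoC; cbn; f_equal; ring).
         rewrite Cmod_mult, Cmod_Ci, Cmod_R, Rabs_pos_eq by nra. ring. }
    replace (D / m * (exp (- (K * s)) * K)) with (D * exp (- (K * s)) * (k * r))
      by (unfold K; field; lra).
    apply Rmult_le_compat_r; [nra|].
    eapply Rle_trans; [exact E|]. apply Req_le. do 3 f_equal.
    unfold K, m, Re, Im, Cplus, Cmult, RtoC; cbn [fst snd]. ring.
  - rewrite (RInt_scal (V := R_CompleteNormedModule) (fun s => exp (- (K * s)) * K)).
    + rewrite RInt_exp_decay. assert (0 < exp (- K)) by apply exp_pos.
      change (scal (D / m) (1 - exp (- K))) with (D / m * (1 - exp (- K))). nra.
    + apply ex_RInt_of_derive. intros s; auto_derive; trivial.
Qed.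

(** The exponent on the ray is [- (p s - q) k s], a quadratic polynomial in [s] with negative
    leading coefficient, and [- p k s^2 + (q k + 1) s <= (q k + 1)^2 / (4 p k)]. *)
Lemma ray_damped (s : R) : 0 <= s ->
  Cmod (f (0 + s * (1%R, k))%C) <= D * exp ((q * k + 1) ^ 2 / (4 * (p * k))) * exp (- s).
Proof.
  intros Hs.
  assert (E := on_wedge_ray _ s Hs Hbound s).
  rewrite Rmin_left, Rmax_right in E by lra. specialize (E ltac:(lra)).
  unfold damped in E. eapply Rle_trans; [exact E|].
  rewrite Rmult_assoc, <- exp_plus. apply Rmult_le_compat_l; [assumption|].
  apply exp_mono. unfold Re, Im, Cplus, Cmult, RtoC; cbn [fst snd].
  set (a := p * k). assert (Ha : 0 < a) by (unfold a; nra).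
  assert (H : 0 <= (2 * a * s - (q * k + 1)) ^ 2 / (4 * a))
    by (apply Rdiv_le_0_compat; [apply pow2_ge_0|lra]).
  replace ((2 * a * s - (q * k + 1)) ^ 2 / (4 * a))
    with (a * s ^ 2 - (q * k + 1) * s + (q * k + 1) ^ 2 / (4 * a)) in H by (field; lra).
  unfold a in *. lra.
Qed.

(** On the ray, domination by [exp (- s)] gives convergence; on the half-line there may be no
    absolute convergence, and the limit exists because the vertical
    side contributes nothing in the limit. *)
Lemma rotation : exists l,
  tends_at_infinity (line_int f 0 1 0) l /\ tends_at_infinity (line_int f 0 (1, k) 0) l.
Proof.
  destruct (tends_RInt_exp_dominated (fun s : R => f (0 + s * (1%R, k)) * (1%R, k))%C
    (D * exp ((q * k + 1) ^ 2 / (4 * (p * k))) * Cmod (1, k))) as [l Hl].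
  - repeat apply Rmult_le_pos; [assumption|apply Rlt_le, exp_pos|apply Cmod_ge_0].
  - intros r Hr. now apply ex_line_int, on_wedge_ray.
  - intros s Hs. rewrite Cmod_mult.
    assert (E := ray_damped s Hs).
    replace (D * exp ((q * k + 1) ^ 2 / (4 * (p * k))) * Cmod (1, k) * exp (- s))
      with (D * exp ((q * k + 1) ^ 2 / (4 * (p * k))) * exp (- s) * Cmod (1, k)) by ring.
    apply Rmult_le_compat_r; [apply Cmod_ge_0|exact E].
  - exists l. split; [|exact Hl].
    assert (Hv : tends_at_infinity (fun r => line_int f r (0%R, (k * r)%R) 0 1) 0).
    { intros eps Heps.
      exists (Rmax 1 ((q + D / eps + 1) / p)). intros r Hr.
      assert (M0 := Rmax_l 1 ((q + D / eps + 1) / p)).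
      assert (M1 := Rmax_r 1 ((q + D / eps + 1) / p)).
      assert (Hr' : (q + D / eps + 1) / p <= r) by lra.
      apply Rle_div_l in Hr'; [|assumption].
      assert (HDe : 0 <= D / eps) by (apply Rdiv_le_0_compat; lra).
      match goal with |- Cmod (?z - RtoC 0) < _ => replace (z - 0)%C with z by ring end.
      eapply Rle_lt_trans; [apply vertical_edge_le; lra|].
      apply Rlt_div_l; [lra|].
      replace D with (eps * (D / eps)) at 1 by (field; lra). nra. }
    apply (tends_ext_pos (fun r => line_int f 0 (1%R, k) 0 r - line_int f r (0%R, (k * r)%R) 0 1)%C).
    + intros r Hr. rewrite <- wedge_triangle by lra. ring.
    + replace l with (l - 0)%C by ring. now apply tends_minus.
Qed.

End Rotation.

(** After the rotation a small difference on the ray gives a small difference of the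
    integrals, although the difference on the real half-line need not be small. *)
Lemma rotation_stability (f g : C -> C) (k delta : R) (l m : C) :
  0 < k -> 0 <= delta ->
  on_wedge k (ex_Cderive f) -> on_wedge k (ex_Cderive g) ->
  (forall s, 0 <= s -> Cmod (f (s, (k * s)%R) - g (s, (k * s)%R)) <= delta * exp (- s)) ->
  tends_at_infinity (line_int f 0 (1, k) 0) l ->
  tends_at_infinity (line_int g 0 (1, k) 0) m ->
  Cmod (l - m) <= delta * (1 + k).
Proof.
  intros Hk Hdelta Hf Hg Hfg Hl Hm.
  apply (Cmod_tends_le _ _ _ (tends_minus _ _ _ _ Hl Hm)).
  intros r Hr.
  assert (Hf' := on_wedge_ray k Hk _ r Hr Hf).
  assert (Hg' := on_wedge_ray k Hk _ r Hr Hg).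
  rewrite <- line_int_minus by assumption.
  assert (HM : 0 <= delta * (1 + k)) by nra.
  eapply Rle_trans; [apply (Cmod_RInt_exp_le _ 0 r (delta * (1 + k)))|].
  - assumption.
  - assumption.
  - apply (ex_line_int (fun z => f z - g z)%C 0 (1%R, k) 0 r).
    intros s Hs. apply ex_Cderive_plus; [now apply Hf'|].
    apply (ex_Cderive_ext (fun z => - (1) * g z)%C); [intros; ring|].
    apply ex_Cderive_mult; [apply ex_Cderive_const|now apply Hg'].
  - intros s Hs. rewrite Cmod_mult.
    replace (0 + s * (1%R, k))%C with ((s, (k * s)%R) : C)
      by (unfold Cplus, Cmult, RtoC; cbn; f_equal; ring).
    replace (delta * (1 + k) * exp (- s)) with (delta * exp (- s) * (1 + k)) by ring.
    apply Rmult_le_compat; [apply Cmod_ge_0|apply Cmod_ge_0|apply Hfg; lra|].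
    eapply Rle_trans; [apply Cmod_le_sum|]. cbn [fst snd].
    rewrite Rabs_R1, Rabs_pos_eq; lra.
  - rewrite Ropp_0, exp_0. lra.
Qed.

(** The topology of [C] in the library is that of the product; this turns its neighbourhoods
    into discs. *)
Lemma locally_Cmod (l : C) (P : C -> Prop) :
  locally (T := C_R_NormedModule) l P -> exists eps, 0 < eps /\ forall z, Cmod (z - l) < eps -> P z.
Proof.
  intros [e He]. exists e. split; [apply cond_pos|]. intros z Hz. apply He.
  exact (C_NormedModule_mixin_compat1 l z e Hz).
Qed.

Lemma RInt_gen_at_p_infty (g : R -> C) (I : R -> C) (l : C) :
  (forall r, 0 < r -> is_CRInt g 0 r (I r)) -> tends_at_infinity I l ->
  RInt_gen (V := C_R_CompleteNormedModule) g (at_point 0) (Rbar_locally p_infty) = l.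
Proof.
  intros Hg Hl.
  apply (is_RInt_gen_unique (V := C_R_CompleteNormedModule)); intros P HP.
  destruct (locally_Cmod l P HP) as [eps [Heps H]]. destruct (Hl eps Heps) as [R0 HR].
  apply (Filter_prod _ _ _ (fun a => a = 0) (fun r => Rmax R0 0 < r)).
  - reflexivity.
  - exists (Rmax R0 0); auto.
  - intros a r -> Hr. assert (M0 := Rmax_l R0 0). assert (M1 := Rmax_r R0 0).
    exists (I r). split; [apply Hg; lra|apply H, HR; lra].
Qed.

Lemma RInt_gen_at_m_infty (g : R -> C) (I : R -> C) (l : C) :
  (forall r, 0 < r -> is_CRInt g (- r) 0 (I r)) -> tends_at_infinity I l ->
  RInt_gen (V := C_R_CompleteNormedModule) g (Rbar_locally m_infty) (at_point 0) = l.
Proof.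
  intros Hg Hl.
  apply (is_RInt_gen_unique (V := C_R_CompleteNormedModule)); intros P HP.
  destruct (locally_Cmod l P HP) as [eps [Heps H]]. destruct (Hl eps Heps) as [R0 HR].
  apply (Filter_prod _ _ _ (fun r => r < - Rmax R0 0) (fun a => a = 0)).
  - exists (- Rmax R0 0); auto.
  - reflexivity.
  - intros r a Hr ->. assert (M0 := Rmax_l R0 0). assert (M1 := Rmax_r R0 0).
    exists (I (- r)). split; [|apply H, HR; lra].
    cbn [fst snd]. replace r with (- - r) at 1 by ring. apply Hg; lra.
Qed.

(** * Analytic continuation of the Green's function *)

Definition phase (t : R) (z : C) : C := Cexp (- (z ^ 2 / (4 * Ci * t))).

(** The formula of the Green's function with a complex number in place of [|y|]: [a] stands for
    [|x|], and [e] for [x] or [- x] according to the side of the origin. *)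
Definition kernel (t w1 w2 a e : R) (m1 m2 m0 : C) (z : C) : C :=
  ((m1 * Lambda ((a + z) / (2 * sqrt_i t) + w1 * sqrt_i t)
    + m2 * Lambda ((a + z) / (2 * sqrt_i t) + w2 * sqrt_i t)) * phase t (a + z)
   + / (2 * sqrt_i (PI * t)) * (m0 * phase t (a + z) + phase t (e - z)))%C.

Lemma Cmod_phase (t : R) (z : C) : 0 < t ->
  Cmod (phase t z) = exp (- (Re z * Im z / (2 * t))).
Proof.
  intros Ht. unfold phase. rewrite Cmod_Cexp. f_equal.
  replace (- (z ^ 2 / (4 * Ci * t)))%C with (Ci * (RtoC (/ (4 * t)) * z ^ 2))%C.
  - destruct z as [a b]. unfold Ci, RtoC, Cpow, Cmult, Re, Im; cbn [fst snd].
    unfold RtoC; cbn [fst snd].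
    field; lra.
  - assert (HC : (Ci * Ci = - (1))%C)
      by (unfold Ci, Cmult, Copp, RtoC; cbn; f_equal; ring).
    assert (Ht' : RtoC t <> 0) by (intros E; apply RtoC_inj in E; lra).
    assert (HCi : Ci <> 0) by (intros E; injection E; lra).
    rewrite RtoC_inv, RtoC_mult by lra.
    replace (- (z ^ 2 / (4 * Ci * t)))%C with (- (1) * (z ^ 2 / (4 * Ci * t)))%C by ring.
    rewrite <- HC. field. auto.
Qed.

Lemma sqrt_i_eq (t : R) :
  sqrt_i t = ((sqrt t * cos (PI / 4), sqrt t * cos (PI / 4)) : C).
Proof.
  unfold sqrt_i, Cexp. replace (Re (Ci * (PI / 4)%R)) with 0
    by (unfold Re, Ci, RtoC, Cmult; cbn [fst snd]; ring).
  replace (Im (Ci * (PI / 4)%R)) with (PI / 4)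
    by (unfold Im, Ci, RtoC, Cmult; cbn [fst snd]; ring).
  rewrite exp_0, sin_PI4, cos_PI4.
  unfold RtoC, Cmult; cbn [fst snd]. f_equal; ring.
Qed.

Lemma Cmod_sqrt_i (t : R) : Cmod (sqrt_i t) = sqrt t.
Proof.
  unfold sqrt_i. rewrite Cmod_mult, Cmod_Cexp, Cmod_R, Rabs_pos_eq by apply sqrt_pos.
  replace (Re (Ci * (PI / 4)%R)) with 0
    by (unfold Re, Ci, RtoC, Cmult; cbn [fst snd]; ring).
  rewrite exp_0; ring.
Qed.

Lemma cos_PI4_bounds : 0 < cos (PI / 4) <= 1.
Proof.
  split; [apply cos_gt_0; assert (H := PI_RGT_0); lra|apply COS_bound].
Qed.

(** Dividing by [sqrt_i t] turns the plane by [- PI / 4], which maps the first quadrant into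
    the right half-plane.  This is why [Lambda] stays bounded on the whole wedge. *)
Lemma Re_div_sqrt_i (t : R) (z : C) :
  0 < t -> 0 <= fst z -> 0 <= snd z -> 0 <= Re (z / (2 * sqrt_i t)).
Proof.
  intros Ht Hx Hy. rewrite sqrt_i_eq.
  assert (Hs := sqrt_lt_R0 t Ht). assert (Hc := cos_PI4_bounds).
  set (c := sqrt t * cos (PI / 4)).
  assert (Hc' : 0 < c) by (apply Rmult_lt_0_compat; lra).
  destruct z as [x y].
  unfold Cdiv, Cinv, RtoC, Cmult, Re; cbn [fst snd] in *.
  replace (2 * c - 0 * c) with (2 * c) by ring.
  replace (2 * c + 0 * c) with (2 * c) by ring.
  match goal with |- 0 <= ?e => replace e with ((x + y) / (4 * c)) end.
  - apply Rdiv_le_0_compat; lra.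
  - field. split; nra.
Qed.

Lemma ex_Cderive_affine (u v z : C) : ex_Cderive (fun z => u + v * z)%C z.
Proof.
  apply ex_Cderive_plus; [apply ex_Cderive_const|].
  apply ex_Cderive_mult; [apply ex_Cderive_const|apply ex_Cderive_id].
Qed.

Lemma ex_Cderive_phase (t : R) (z : C) : ex_Cderive (phase t) z.
Proof.
  apply (ex_Cderive_comp Cexp (fun z => - (z ^ 2 / (4 * Ci * t)))%C).
  - eexists; apply is_Cderive_Cexp.
  - apply (ex_Cderive_ext (fun z => (- / (4 * Ci * t)) * (z * z))%C).
    { intros w; unfold Cdiv; simpl; ring. }
    apply ex_Cderive_mult; [apply ex_Cderive_const|].
    apply ex_Cderive_mult; apply ex_Cderive_id.
Qed.

Lemma ex_Cderive_kernel (t w1 w2 a e : R) (m1 m2 m0 z : C) :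
  ex_Cderive (kernel t w1 w2 a e m1 m2 m0) z.
Proof.
  assert (HL : forall w, ex_Cderive (fun z => Lambda ((a + z) / (2 * sqrt_i t) + w)) z).
  { intros w. apply (ex_Cderive_comp Lambda (fun z => (a + z) / (2 * sqrt_i t) + w)%C);
      [apply ex_Cderive_Lambda|].
    apply (ex_Cderive_ext (fun z => (a / (2 * sqrt_i t) + w) + / (2 * sqrt_i t) * z)%C).
    { intros y; unfold Cdiv; ring. }
    apply ex_Cderive_affine. }
  assert (HE : ex_Cderive (fun z => phase t (a + z)) z).
  { apply (ex_Cderive_comp (phase t) (fun z => a + z)%C); [apply ex_Cderive_phase|].
    apply ex_Cderive_plus; [apply ex_Cderive_const|apply ex_Cderive_id]. }
  assert (HE' : ex_Cderive (fun z => phase t (e - z)) z).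
  { apply (ex_Cderive_comp (phase t) (fun z => e - z)%C); [apply ex_Cderive_phase|].
    apply (ex_Cderive_ext (fun z => e + - (1) * z)%C); [intros; ring|].
    apply ex_Cderive_affine. }
  unfold kernel.
  apply ex_Cderive_plus; (apply ex_Cderive_mult; [|]).
  - apply ex_Cderive_plus; (apply ex_Cderive_mult; [apply ex_Cderive_const|apply HL]).
  - exact HE.
  - apply ex_Cderive_const.
  - apply ex_Cderive_plus; [|exact HE'].
    apply ex_Cderive_mult; [apply ex_Cderive_const|exact HE].
Qed.

Definition kernel_const (t0 T W m : R) : R :=
  4 * m * exp ((2 * (W * sqrt T) + 1) ^ 2 / 4) + / (2 * sqrt (PI * t0)) * (m + 1).

Lemma kernel_const_ge_0 (t0 T W m : R) : 0 < t0 -> 0 <= m -> 0 <= kernel_const t0 T W m.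
Proof.
  intros Ht0 Hm. assert (HPI := PI_RGT_0).
  assert (0 < sqrt (PI * t0)) by (apply sqrt_lt_R0; nra).
  assert (0 < / (2 * sqrt (PI * t0))) by (apply Rinv_0_lt_compat; lra).
  assert (HM := exp_pos ((2 * (W * sqrt T) + 1) ^ 2 / 4)).
  unfold kernel_const. nra.
Qed.

Lemma Lambda_kernel_bound (t T w W a : R) (z : C) :
  0 < t <= T -> Rabs w <= W -> 0 <= a -> 0 <= fst z -> 0 <= snd z ->
  Cmod (Lambda ((a + z) / (2 * sqrt_i t) + w * sqrt_i t))
    <= 2 * exp ((2 * (W * sqrt T) + 1) ^ 2 / 4).
Proof.
  intros Ht Hw Ha Hx Hy. apply Lambda_bounded.
  rewrite re_plus.
  assert (H1 : 0 <= Re ((a + z) / (2 * sqrt_i t))).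
  { apply Re_div_sqrt_i; [lra| |]; destruct z; unfold Cplus, RtoC; cbn [fst snd] in *; lra. }
  assert (H2 : Rabs (Re (w * sqrt_i t)) <= W * sqrt T).
  { eapply Rle_trans; [apply re_le_Cmod|].
    rewrite Cmod_mult, Cmod_R, Cmod_sqrt_i.
    apply Rmult_le_compat; [apply Rabs_pos|apply sqrt_pos|assumption|].
    apply sqrt_le_1_alt; lra. }
  apply Rabs_le_between in H2. lra.
Qed.

(** The reflected wave, with its phase at [a + z], decays on the whole quadrant; the direct
    wave, with its phase at [e - z], decays only where [X] exceeds [e], hence the shift by
    [xi]. *)
Lemma kernel_bound (t t0 T w1 w2 W a e xi m : R) (m1 m2 m0 : C) (X Y : R) :
  0 < t0 -> t0 <= t <= T -> Rabs w1 <= W -> Rabs w2 <= W ->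
  0 <= a <= xi -> Rabs e <= xi ->
  Cmod m1 <= m -> Cmod m2 <= m -> Cmod m0 <= m -> 0 <= X -> 0 <= Y ->
  Cmod (kernel t w1 w2 a e m1 m2 m0 (X, Y)) <=
    kernel_const t0 T W m * exp (- ((X - xi) * Y / (2 * t))).
Proof.
  intros Ht0 Ht Hw1 Hw2 Ha He Hm1 Hm2 Hm0 HX HY.
  assert (Htp : 0 < t) by lra.
  set (E := exp (- ((X - xi) * Y / (2 * t)))).
  set (M := exp ((2 * (W * sqrt T) + 1) ^ 2 / 4)).
  assert (HE1 : Cmod (phase t (a + (X, Y))) <= E).
  { rewrite Cmod_phase by assumption. apply exp_mono, Ropp_le_contravar.
    unfold Cplus, RtoC, Re, Im; cbn [fst snd].
    apply Rmult_le_compat_r; [apply Rlt_le, Rinv_0_lt_compat; lra|].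
    rewrite Rplus_0_l. apply Rmult_le_compat_r; lra. }
  assert (HE2 : Cmod (phase t (e - (X, Y))) <= E).
  { rewrite Cmod_phase by assumption. apply exp_mono, Ropp_le_contravar.
    unfold Cminus, Cplus, Copp, RtoC, Re, Im; cbn [fst snd].
    apply Rmult_le_compat_r; [apply Rlt_le, Rinv_0_lt_compat; lra|].
    apply Rabs_le_between in He.
    replace ((e + - X) * (0 + - Y)) with ((X - e) * Y) by ring.
    apply Rmult_le_compat_r; lra. }
  assert (HL1 := Lambda_kernel_bound t T w1 W a (X, Y) ltac:(lra) Hw1 ltac:(lra) HX HY).
  assert (HL2 := Lambda_kernel_bound t T w2 W a (X, Y) ltac:(lra) Hw2 ltac:(lra) HX HY).
  fold M in HL1, HL2.
  assert (HEp : 0 < E) by apply exp_pos.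
  assert (HMp : 0 < M) by apply exp_pos.
  assert (Hmp : 0 <= m) by (eapply Rle_trans; [apply Cmod_ge_0|exact Hm1]).
  assert (HS : Cmod (/ (2 * sqrt_i (PI * t))) <= / (2 * sqrt (PI * t0))).
  { assert (HPI := PI_RGT_0).
    assert (H0 : 0 < sqrt (PI * t0)) by (apply sqrt_lt_R0; nra).
    assert (H1 : sqrt (PI * t0) <= sqrt (PI * t)) by (apply sqrt_le_1_alt; nra).
    rewrite Cmod_inv.
    - rewrite Cmod_mult, Cmod_R, Cmod_sqrt_i, Rabs_pos_eq by lra.
      apply Rinv_le_contravar; lra.
    - apply Cmod_gt_0. rewrite Cmod_mult, Cmod_R, Cmod_sqrt_i, Rabs_pos_eq; lra. }
  unfold kernel, kernel_const. fold M.
  eapply Rle_trans; [apply Cmod_triangle|]. rewrite Rmult_plus_distr_r.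
  apply Rplus_le_compat; rewrite Cmod_mult.
  - apply Rmult_le_compat; try apply Cmod_ge_0; [|assumption].
    eapply Rle_trans; [apply Cmod_triangle|]. rewrite !Cmod_mult.
    replace (4 * m * M) with (m * (2 * M) + m * (2 * M)) by ring.
    apply Rplus_le_compat; apply Rmult_le_compat; try apply Cmod_ge_0; assumption.
  - rewrite (Rmult_assoc (/ (2 * sqrt (PI * t0)))).
    apply Rmult_le_compat; try apply Cmod_ge_0; [assumption|].
    eapply Rle_trans; [apply Cmod_triangle|]. rewrite Cmod_mult.
    assert (Cmod m0 * Cmod (phase t (a + (X, Y))) <= m * E)
      by (apply Rmult_le_compat; try apply Cmod_ge_0; assumption).
    lra.
Qed.

(** ** The coefficients depend only on the signs of their arguments *)

Lemma eta_same_sign (alpha beta : C) (x y x' y' : R) :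
  0 < x * x' -> 0 < y * y' -> eta alpha beta x y = eta alpha beta x' y'.
Proof.
  intros Hx Hy. unfold eta. destruct Req_EM_T; [reflexivity|]. f_equal.
  destruct (Rlt_dec 0 x), (Rlt_dec 0 x'), (Rlt_dec 0 y), (Rlt_dec 0 y');
    try reflexivity; exfalso; nra.
Qed.

Lemma Theta_same_sign (x x' : R) : 0 < x * x' -> Theta x = Theta x'.
Proof.
  intros Hx. unfold Theta.
  destruct (Rlt_dec 0 x), (Rlt_dec 0 x'); try reflexivity; exfalso; nra.
Qed.

Lemma sign_same_sign (x x' : R) : 0 < x * x' -> sign x = sign x'.
Proof.
  intros Hx. destruct (Rtotal_order x 0) as [H|[H|H]].
  - rewrite !sign_eq_m1; [reflexivity| |assumption]. nra.
  - nra.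
  - rewrite !sign_eq_1; [reflexivity| |assumption]. nra.
Qed.

(** This is what makes the Green's function analytic in [y] on either half-line. *)
Lemma mu_same_sign (phi : R) (alpha beta : C) (x y x' y' : R) :
  0 < x * x' -> 0 < y * y' ->
  mu_plus phi alpha beta x y = mu_plus phi alpha beta x' y' /\
  mu_minus phi alpha beta x y = mu_minus phi alpha beta x' y' /\
  mu_0 phi alpha beta x y = mu_0 phi alpha beta x' y'.
Proof.
  intros Hx Hy.
  assert (Hxy : 0 < (x * y) * (x' * y'))
    by (replace ((x * y) * (x' * y')) with ((x * x') * (y * y')) by ring; nra).
  unfold mu_plus, mu_minus, mu_0.
  rewrite (eta_same_sign alpha beta x y x' y' Hx Hy), (Theta_same_sign _ _ Hxy),
    (sign_same_sign _ _ Hxy), (Theta_same_sign (- (x * y)) (- (x' * y'))) by lra.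
  auto.
Qed.

Definition is_sign (s : R) : Prop := s = 1 \/ s = -1.

Lemma mu_bounded (phi : R) (alpha beta : C) : exists m, 0 <= m /\
  forall x s, x <> 0 -> is_sign s ->
    Cmod (mu_plus phi alpha beta x s) <= m /\
    Cmod (mu_minus phi alpha beta x s) <= m /\
    Cmod (mu_0 phi alpha beta x s) <= m.
Proof.
  set (S := fun u v => Cmod (mu_plus phi alpha beta u v) + Cmod (mu_minus phi alpha beta u v)
            + Cmod (mu_0 phi alpha beta u v)).
  assert (HS : forall u v, 0 <= S u v).
  { intros u v. unfold S.
    assert (H1 := Cmod_ge_0 (mu_plus phi alpha beta u v)).
    assert (H2 := Cmod_ge_0 (mu_minus phi alpha beta u v)).
    assert (H3 := Cmod_ge_0 (mu_0 phi alpha beta u v)). lra. }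
  exists (S 1 1 + S 1 (-1) + S (-1) 1 + S (-1) (-1)).
  assert (H11 := HS 1 1). assert (H12 := HS 1 (-1)).
  assert (H21 := HS (-1) 1). assert (H22 := HS (-1) (-1)).
  split; [lra|]. intros x s Hx Hs.
  assert (Hle : S x s <= S 1 1 + S 1 (-1) + S (-1) 1 + S (-1) (-1)).
  { assert (Hx' : exists u, is_sign u /\ 0 < x * u).
    { destruct (Rdichotomy _ _ Hx); [exists (-1); unfold is_sign|exists 1; unfold is_sign]; split; auto; lra. }
    destruct Hx' as [u [Hu Hxu]].
    assert (E : S x s = S u s).
    { unfold S. destruct (mu_same_sign phi alpha beta x s u s) as [E1 [E2 E3]];
        [assumption|destruct Hs as [-> | ->]; lra|]. now rewrite E1, E2, E3. }
    rewrite E. destruct Hs as [-> | ->], Hu as [-> | ->]; lra. }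
  unfold S at 1 in Hle.
  assert (H1 := Cmod_ge_0 (mu_plus phi alpha beta x s)).
  assert (H2 := Cmod_ge_0 (mu_minus phi alpha beta x s)).
  assert (H3 := Cmod_ge_0 (mu_0 phi alpha beta x s)).
  repeat split; lra.
Qed.

Definition Green_branch (phi : R) (alpha beta : C) (t x s : R) : C -> C :=
  kernel t (omega_plus phi alpha) (omega_minus phi alpha) (Rabs x) (s * x)
    (mu_plus phi alpha beta x s) (mu_minus phi alpha beta x s) (mu_0 phi alpha beta x s).

(** The factor [s] is the side of the origin on which the half-line lies.  Reflecting the
    negative half-line turns [(x - s r)^2] into [(s x - r)^2], so that the same [kernel] and
    the same sector serve both sides. *)
Lemma Green_eq_branch (phi : R) (alpha beta : C) (t x s r : R) :
  x <> 0 -> is_sign s -> 0 < r ->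
  Green phi alpha beta t x (s * r) = Green_branch phi alpha beta t x s r.
Proof.
  intros Hx Hs Hr. unfold Green, Green_branch, kernel, phase.
  destruct (mu_same_sign phi alpha beta x (s * r) x s) as [E1 [E2 E3]].
  { destruct (Rdichotomy _ _ Hx); nra. }
  { destruct Hs as [-> | ->]; lra. }
  rewrite E1, E2, E3.
  assert (Hsr : Rabs (s * r) = r).
  { rewrite Rabs_mult, (Rabs_pos_eq r) by lra.
    destruct Hs as [-> | ->]; [rewrite Rabs_R1|rewrite Rabs_left by lra]; ring. }
  rewrite Hsr.
  replace ((x - s * r) ^ 2) with ((s * x - r) ^ 2) by (destruct Hs as [-> | ->]; ring).
  rewrite !RtoC_pow, RtoC_plus, RtoC_minus. reflexivity.
Qed.

(** * Continuity of the wave function in its initial datum *)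

(** Polar coordinates: the angle is [atan (Y / X)]. *)
Lemma wedge_in_sector (alpha0 : R) :
  0 < alpha0 < PI / 2 -> on_wedge (tan alpha0) (sector alpha0).
Proof.
  intros Ha X Y HXY.
  assert (Hk : 0 < tan alpha0) by (apply tan_gt_0; lra).
  assert (HX : 0 <= X) by nra.
  destruct (Rle_lt_or_eq_dec 0 X HX) as [HX'|<-].
  - assert (HYX : 0 <= Y / X <= tan alpha0).
    { split; [apply Rdiv_le_0_compat; lra|apply Rle_div_l; lra]. }
    set (theta := atan (Y / X)).
    assert (Htheta : 0 <= theta <= alpha0).
    { split.
      - unfold theta. rewrite <- atan_0.
        destruct (Rle_lt_or_eq_dec _ _ (proj1 HYX)) as [H| <-];
          [apply Rlt_le, atan_increasing, H|apply Rle_refl].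
      - unfold theta. rewrite <- (atan_tan alpha0) by lra.
        destruct (Rle_lt_or_eq_dec _ _ (proj2 HYX)) as [H| ->];
          [apply Rlt_le, atan_increasing, H|apply Rle_refl]. }
    assert (Hc : 0 < cos theta) by (apply cos_gt_0; lra).
    exists (X / cos theta), theta. split; [apply Rdiv_le_0_compat; lra|].
    split; [assumption|].
    assert (Htan : sin theta / cos theta = Y / X) by (apply (tan_atan (Y / X))).
    unfold Cexp.
    replace (Re (Ci * theta)) with 0
      by (unfold Re, Ci, RtoC, Cmult; cbn [fst snd]; ring).
    replace (Im (Ci * theta)) with theta
      by (unfold Im, Ci, RtoC, Cmult; cbn [fst snd]; ring).
    rewrite exp_0. unfold RtoC, Cmult; cbn [fst snd]. f_equal.
    + field. lra.
    + replace Y with (X * (Y / X)) by (field; lra). rewrite <- Htan. field. lra.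
  - replace Y with 0 by nra.
    exists 0, 0. split; [lra|]. split; [lra|].
    unfold RtoC, Cmult; cbn [fst snd]. f_equal; ring.
Qed.

Lemma double_sector_sign (alpha0 s : R) (z : C) :
  is_sign s -> sector alpha0 z -> double_sector alpha0 (s * z).
Proof.
  intros [-> | ->] Hz; [left|right].
  - now replace (1 * z)%C with z by ring.
  - now replace (- (-1 * z))%C with z by ring.
Qed.

Lemma is_RInt_reflect (h : R -> C) (r : R) (l : C) :
  is_CRInt h 0 r l -> is_CRInt (fun y => h (- y)) (- r) 0 l.
Proof.
  intros H.
  assert (H1 : is_CRInt h (- - r) (- 0) (opp (G := C_R_NormedModule) l)).
  { rewrite Ropp_involutive, Ropp_0. now apply is_RInt_swap. }
  apply is_RInt_comp_opp, is_RInt_opp in H1.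
  rewrite opp_opp in H1. eapply is_RInt_ext; [|exact H1].
  intros y _. cbn beta. apply (opp_opp (G := C_R_NormedModule)).
Qed.

Definition branch_integrand (phi : R) (alpha beta : C) (t x s : R) (F : C -> C) (z : C) : C :=
  (Green_branch phi alpha beta t x s z * F (s * z))%C.

(** The Green's function takes an arbitrary value at [y = 0]; equality of the integrands on
    the open half-lines suffices. *)
Lemma Psi_eq (phi : R) (alpha beta : C) (t x : R) (F : C -> C) (lp lm : C) :
  x <> 0 ->
  (forall s r, is_sign s -> 0 < r ->
     on_line (ex_Cderive (branch_integrand phi alpha beta t x s F)) 0 1 0 r) ->
  tends_at_infinity (line_int (branch_integrand phi alpha beta t x 1 F) 0 1 0) lp ->
  tends_at_infinity (line_int (branch_integrand phi alpha beta t x (-1) F) 0 1 0) lm ->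
  Psi phi alpha beta t x F = (lm + lp)%C.
Proof.
  intros Hx Hex Hp Hm.
  assert (Hline : forall s r, is_sign s -> 0 < r -> is_CRInt
    (fun y => Green phi alpha beta t x (s * y) * F (RtoC (s * y)))%C 0 r
    (line_int (branch_integrand phi alpha beta t x s F) 0 1 0 r)).
  { intros s r Hs Hr.
    eapply is_RInt_ext;
      [|apply (RInt_correct (V := C_R_CompleteNormedModule)), ex_line_int, Hex; assumption].
    intros y Hy. rewrite Rmin_left in Hy by lra. cbn beta. unfold branch_integrand.
    replace (0 + y * 1)%C with (RtoC y) by ring.
    rewrite Green_eq_branch, RtoC_mult by (assumption || lra). eq_in C. ring. }
  unfold Psi. f_equal.
  - eapply RInt_gen_at_m_infty; [|exact Hm]. intros r Hr.
    eapply is_RInt_ext; [|apply is_RInt_reflect, (Hline (-1) r); [now right|assumption]].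
    intros y _. cbn beta. now replace (-1 * - y)%R with y by ring.
  - eapply RInt_gen_at_p_infty; [|exact Hp]. intros r Hr.
    eapply is_RInt_ext; [|apply (Hline 1 r); [now left|assumption]].
    intros y _. cbn beta. now rewrite Rmult_1_l.
Qed.

(** ** Estimates uniform for (t, x) in a box *)

Definition stability_const (t0 T xi W m k C0 : R) : R :=
  2 * (kernel_const t0 T W m *
    exp ((k * xi / (2 * t0) + C0 * (1 + k) + 1) ^ 2 * T / (2 * k)) * (1 + k)).

(** With [b] the coefficient of [s] after moving [- s] to the left, the quadratic polynomial
    [b s - k s^2 / (2 T)] is at most [b^2 T / (2 k)].  Replacing [t] by [T] in the quadratic
    term and by [t0] in the linear term makes the bound independent of [t]. *)
Lemma ray_exponent (t t0 T xi k C0 s : R) :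
  0 < t0 -> t0 <= t <= T -> 0 <= xi -> 0 < k -> 0 <= s ->
  - ((s - xi) * (k * s) / (2 * t)) + C0 * ((1 + k) * s) <=
  (k * xi / (2 * t0) + C0 * (1 + k) + 1) ^ 2 * T / (2 * k) + - s.
Proof.
  intros Ht0 Ht Hxi Hk Hs.
  set (b := k * xi / (2 * t0) + C0 * (1 + k) + 1).
  assert (H1 : k * s ^ 2 / (2 * T) <= k * s ^ 2 / (2 * t)).
  { apply Rmult_le_compat_l; [nra|]. apply Rinv_le_contravar; lra. }
  assert (H2 : k * xi * s / (2 * t) <= k * xi * s / (2 * t0)).
  { apply Rmult_le_compat_l; [apply Rmult_le_pos; [nra|lra]|]. apply Rinv_le_contravar; lra. }
  replace (- ((s - xi) * (k * s) / (2 * t)))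
    with (- (k * s ^ 2 / (2 * t)) + k * xi * s / (2 * t)) by (field; lra).
  assert (H3 : 0 <= (k * s - b * T) ^ 2 / (2 * k * T))
    by (apply Rdiv_le_0_compat; [apply pow2_ge_0|nra]).
  replace ((k * s - b * T) ^ 2 / (2 * k * T))
    with (k * s ^ 2 / (2 * T) - b * s + b ^ 2 * T / (2 * k)) in H3 by (field; lra).
  replace (b * s) with (k * xi * s / (2 * t0) + C0 * ((1 + k) * s) + s) in H3
    by (unfold b; field; lra).
  lra.
Qed.

Section Box.

Variables (phi : R) (alpha beta : C) (alpha0 : R) (Omega : C -> Prop).
Hypothesis Halpha0 : 0 < alpha0 < PI / 2.
Hypothesis Hsub : forall z : C, double_sector alpha0 z -> Omega z.

Variables (t0 T xi m : R).
Hypothesis Ht0 : 0 < t0.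
Hypothesis Hm0 : 0 <= m.
Hypothesis Hm : forall x s, x <> 0 -> is_sign s ->
    Cmod (mu_plus phi alpha beta x s) <= m /\
    Cmod (mu_minus phi alpha beta x s) <= m /\
    Cmod (mu_0 phi alpha beta x s) <= m.

Let k := tan alpha0.
Let W := Rmax (Rabs (omega_plus phi alpha)) (Rabs (omega_minus phi alpha)).

Lemma k_gt_0 : 0 < k.
Proof. apply tan_gt_0; lra. Qed.

Lemma Green_branch_bound (t x s X Y : R) :
  t0 <= t <= T -> x <> 0 -> Rabs x <= xi -> is_sign s -> 0 <= X -> 0 <= Y ->
  Cmod (Green_branch phi alpha beta t x s (X, Y)) <=
    kernel_const t0 T W m * exp (- ((X - xi) * Y / (2 * t))).
Proof.
  intros Ht Hx Hxi Hs HX HY. destruct (Hm x s Hx Hs) as [H1 [H2 H3]].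
  apply kernel_bound; try assumption.
  - apply Rmax_l.
  - apply Rmax_r.
  - split; [apply Rabs_pos|assumption].
  - rewrite Rabs_mult. replace (Rabs s) with 1; [lra|].
    destruct Hs as [-> | ->]; [now rewrite Rabs_R1|rewrite Rabs_left; lra].
Qed.

Lemma ex_Cderive_branch_integrand (t x s : R) (F : C -> C) :
  holomorphic_on Omega F -> is_sign s ->
  on_wedge k (ex_Cderive (branch_integrand phi alpha beta t x s F)).
Proof.
  intros HF Hs X Y HXY. apply ex_Cderive_mult; [apply ex_Cderive_kernel|].
  apply (ex_Cderive_comp F (fun z => s * z)%C).
  - apply HF, Hsub, double_sector_sign; [assumption|]. now apply wedge_in_sector.
  - apply ex_Cderive_mult; [apply ex_Cderive_const|apply ex_Cderive_id].
Qed.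

Lemma branch_integrand_damped (t x s A B : R) (F : C -> C) :
  t0 <= t <= T -> x <> 0 -> Rabs x <= xi -> is_sign s ->
  (forall z, double_sector alpha0 z -> Cmod (F z) <= A * exp (B * Rabs (Im z))) ->
  on_wedge k (damped (kernel_const t0 T W m * A) (/ (2 * t)) (xi / (2 * t) + B)
    (branch_integrand phi alpha beta t x s F)).
Proof.
  intros Ht Hx Hxi Hs HF X Y HXY.
  assert (Hk := k_gt_0). assert (HX : 0 <= X) by nra.
  unfold damped, branch_integrand. rewrite Cmod_mult.
  assert (H1 := Green_branch_bound t x s X Y Ht Hx Hxi Hs HX (proj1 HXY)).
  assert (H2 := HF _ (double_sector_sign alpha0 s (X, Y) Hs (wedge_in_sector alpha0 Halpha0 X Y HXY))).
  replace (Rabs (Im (s * (X, Y)))) with Y in H2.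
  2: { unfold Im, RtoC, Cmult; cbn [fst snd].
       replace (s * Y + 0 * X) with (s * Y) by ring.
       rewrite Rabs_mult, (Rabs_pos_eq Y) by lra.
       destruct Hs as [-> | ->]; [rewrite Rabs_R1|rewrite Rabs_left by lra]; ring. }
  eapply Rle_trans; [apply Rmult_le_compat; [apply Cmod_ge_0|apply Cmod_ge_0|exact H1|exact H2]|].
  apply Req_le.
  replace (- ((/ (2 * t) * Re (X, Y) - (xi / (2 * t) + B)) * Im (X, Y)))
    with (- ((X - xi) * Y / (2 * t)) + B * Y) by (unfold Re, Im; cbn [fst snd]; field; lra).
  rewrite exp_plus. ring.
Qed.

(** The Gaussian decay of the kernel on the ray absorbs the factor [exp (C0 |z|)] and leaves
    [exp (- r)]. *)
Lemma branch_integrand_ray (t x s C0 delta : R) (F G : C -> C) :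
  t0 <= t <= T -> x <> 0 -> Rabs x <= xi -> is_sign s -> 0 <= C0 -> 0 <= delta ->
  (forall z, double_sector alpha0 z -> Cmod (F z - G z) <= delta * exp (C0 * Cmod z)) ->
  forall r, 0 <= r ->
  Cmod (branch_integrand phi alpha beta t x s F (r, (k * r)%R)
        - branch_integrand phi alpha beta t x s G (r, (k * r)%R)) <=
  delta * (kernel_const t0 T W m *
    exp ((k * xi / (2 * t0) + C0 * (1 + k) + 1) ^ 2 * T / (2 * k))) * exp (- r).
Proof.
  intros Ht Hx Hxi Hs HC0 Hdelta HFG r Hr.
  assert (Hk := k_gt_0).
  unfold branch_integrand.
  set (z := (r, (k * r)%R) : C).
  replace (Green_branch phi alpha beta t x s z * F (s * z)
           - Green_branch phi alpha beta t x s z * G (s * z))%C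
    with (Green_branch phi alpha beta t x s z * (F (s * z) - G (s * z)))%C by ring.
  rewrite Cmod_mult.
  assert (Hkr : 0 <= k * r) by nra.
  assert (H1 := Green_branch_bound t x s r (k * r) Ht Hx Hxi Hs Hr Hkr). fold z in H1.
  assert (H2 := HFG _ (double_sector_sign alpha0 s z Hs
    (wedge_in_sector alpha0 Halpha0 r (k * r) (conj Hkr (Rle_refl _))))).
  assert (H3 : Cmod (s * z) <= (1 + k) * r).
  { rewrite Cmod_mult, Cmod_R. replace (Rabs s) with 1
      by (destruct Hs as [-> | ->]; [now rewrite Rabs_R1|rewrite Rabs_left; lra]).
    rewrite Rmult_1_l. eapply Rle_trans; [apply Cmod_le_sum|].
    unfold z; cbn [fst snd]. rewrite !Rabs_pos_eq by assumption. lra. }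
  assert (H4 : exp (C0 * Cmod (s * z)) <= exp (C0 * ((1 + k) * r)))
    by (apply exp_mono, Rmult_le_compat_l; assumption).
  assert (HL := kernel_const_ge_0 t0 T W m Ht0 Hm0).
  assert (Hxi0 : 0 <= xi) by (eapply Rle_trans; [apply Rabs_pos|exact Hxi]).
  assert (H5 := exp_mono _ _ (ray_exponent t t0 T xi k C0 r Ht0 Ht Hxi0 Hk Hr)).
  rewrite !exp_plus in H5.
  eapply Rle_trans; [apply Rmult_le_compat; [apply Cmod_ge_0|apply Cmod_ge_0|exact H1|]|].
  { eapply Rle_trans; [exact H2|]. apply Rmult_le_compat_l; [assumption|exact H4]. }
  set (L := kernel_const t0 T W m) in *.
  replace (L * exp (- ((r - xi) * (k * r) / (2 * t))) * (delta * exp (C0 * ((1 + k) * r))))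
    with (delta * L * (exp (- ((r - xi) * (k * r) / (2 * t))) * exp (C0 * ((1 + k) * r)))) by ring.
  match goal with |- _ <= delta * (L * ?M) * ?e =>
    replace (delta * (L * M) * e) with (delta * L * (M * e)) by ring end.
  apply Rmult_le_compat_l; [now apply Rmult_le_pos|exact H5].
Qed.

(** The bounds on [F] and on [G] make the improper integrals exist and allow their rotation,
    one at a time; the difference is estimated on the ray, in terms of [delta] alone. *)
Lemma Psi_stability (t x C0 delta A B A' B' : R) (F G : C -> C) :
  t0 <= t <= T -> x <> 0 -> Rabs x <= xi -> 0 <= C0 -> 0 <= delta -> 0 <= A -> 0 <= A' ->
  holomorphic_on Omega F -> holomorphic_on Omega G ->
  (forall z, double_sector alpha0 z -> Cmod (F z) <= A * exp (B * Rabs (Im z))) ->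
  (forall z, double_sector alpha0 z -> Cmod (G z) <= A' * exp (B' * Rabs (Im z))) ->
  (forall z, double_sector alpha0 z -> Cmod (F z - G z) <= delta * exp (C0 * Cmod z)) ->
  Cmod (Psi phi alpha beta t x F - Psi phi alpha beta t x G) <=
    delta * stability_const t0 T xi W m k C0.
Proof.
  intros Ht Hx Hxi HC0 Hdelta HA HA' HF HG HFb HGb HFG.
  assert (Hk := k_gt_0).
  assert (HL := kernel_const_ge_0 t0 T W m Ht0 Hm0).
  assert (Hlim : forall D E (H : C -> C), 0 <= D -> holomorphic_on Omega H ->
    (forall z, double_sector alpha0 z -> Cmod (H z) <= D * exp (E * Rabs (Im z))) ->
    forall s, is_sign s -> exists l,
      tends_at_infinity (line_int (branch_integrand phi alpha beta t x s H) 0 1 0) l /\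
      tends_at_infinity (line_int (branch_integrand phi alpha beta t x s H) 0 (1%R, k) 0) l).
  { intros D E H HD HH HHb s Hs.
    apply (rotation _ k (kernel_const t0 T W m * D) (/ (2 * t)) (xi / (2 * t) + E)); try assumption.
    - now apply Rmult_le_pos.
    - apply Rinv_0_lt_compat; lra.
    - now apply ex_Cderive_branch_integrand.
    - now apply branch_integrand_damped. }
  assert (Hs1 : is_sign 1) by now left. assert (Hs2 : is_sign (-1)) by now right.
  destruct (Hlim A B F HA HF HFb 1 Hs1) as [fp [Fp Fp']].
  destruct (Hlim A B F HA HF HFb (-1) Hs2) as [fm [Fm Fm']].
  destruct (Hlim A' B' G HA' HG HGb 1 Hs1) as [gp [Gp Gp']].
  destruct (Hlim A' B' G HA' HG HGb (-1) Hs2) as [gm [Gm Gm']].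
  assert (Hax : forall H, holomorphic_on Omega H -> forall s r, is_sign s -> 0 < r ->
    on_line (ex_Cderive (branch_integrand phi alpha beta t x s H)) 0 1 0 r).
  { intros H HH s r Hs Hr. apply (on_wedge_axis k Hk); [lra|].
    now apply ex_Cderive_branch_integrand. }
  rewrite (Psi_eq phi alpha beta t x F fp fm Hx (Hax F HF) Fp Fm).
  rewrite (Psi_eq phi alpha beta t x G gp gm Hx (Hax G HG) Gp Gm).
  set (Q := kernel_const t0 T W m * exp ((k * xi / (2 * t0) + C0 * (1 + k) + 1) ^ 2 * T / (2 * k))).
  assert (HQ : 0 <= delta * Q).
  { repeat apply Rmult_le_pos; try assumption. apply Rlt_le, exp_pos. }
  assert (Hdiff : forall s l l', is_sign s ->
    tends_at_infinity (line_int (branch_integrand phi alpha beta t x s F) 0 (1%R, k) 0) l ->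
    tends_at_infinity (line_int (branch_integrand phi alpha beta t x s G) 0 (1%R, k) 0) l' ->
    Cmod (l - l') <= delta * Q * (1 + k)).
  { intros s l l' Hs Hl Hl'. eapply rotation_stability; try eassumption.
    - now apply ex_Cderive_branch_integrand.
    - now apply ex_Cderive_branch_integrand.
    - now apply branch_integrand_ray. }
  replace (fm + fp - (gm + gp))%C with ((fm - gm) + (fp - gp))%C by ring.
  eapply Rle_trans; [apply Cmod_triangle|].
  assert (D1 := Hdiff _ _ _ Hs1 Fp' Gp'). assert (D2 := Hdiff _ _ _ Hs2 Fm' Gm').
  unfold stability_const. fold Q.
  replace (delta * (2 * (Q * (1 + k)))) with (delta * Q * (1 + k) + delta * Q * (1 + k)) by ring.
  lra.
Qed.

End Box.

(** ** Compact sets and suprema *)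

Definition box (n : nat) (p : R * R) : Prop :=
  / (INR n + 1) < fst p /\ fst p < INR n + 1 /\ - (INR n + 1) < snd p /\ snd p < INR n + 1.

Lemma open_box (n : nat) : open (T := prod_UniformSpace R_UniformSpace R_UniformSpace) (box n).
Proof.
  assert (Hf : forall D : R -> Prop, open D ->
    open (T := prod_UniformSpace R_UniformSpace R_UniformSpace) (fun p => D (fst p))).
  { intros D HD. apply open_comp; [|assumption]. intros [a b] _. apply continuous_fst. }
  assert (Hs : forall D : R -> Prop, open D ->
    open (T := prod_UniformSpace R_UniformSpace R_UniformSpace) (fun p => D (snd p))).
  { intros D HD. apply open_comp; [|assumption]. intros [a b] _. apply continuous_snd. }
  unfold box. repeat apply open_and.
  - apply (Hf (fun u => / (INR n + 1) < u)), open_gt.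
  - apply (Hf (fun u => u < INR n + 1)), open_lt.
  - apply (Hs (fun u => - (INR n + 1) < u)), open_gt.
  - apply (Hs (fun u => u < INR n + 1)), open_lt.
Qed.

Lemma box_mono (n n' : nat) (p : R * R) : (n <= n')%nat -> box n p -> box n' p.
Proof.
  intros Hn Hp. apply le_INR in Hn. assert (H0 := pos_INR n).
  assert (/ (INR n' + 1) <= / (INR n + 1)) by (apply Rinv_le_contravar; lra).
  unfold box in *. lra.
Qed.

Lemma box_exhausts (t x : R) : 0 < t -> exists n, box n (t, x).
Proof.
  intros Ht.
  destruct (INR_unbounded (Rmax (/ t) (Rmax t (Rabs x)))) as [n Hn]. exists n.
  assert (M1 := Rmax_l (/ t) (Rmax t (Rabs x))). assert (M2 := Rmax_r (/ t) (Rmax t (Rabs x))).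
  assert (M3 := Rmax_l t (Rabs x)). assert (M4 := Rmax_r t (Rabs x)).
  assert (Hx : Rabs x < INR n + 1) by lra.
  apply Rabs_lt_between in Hx.
  assert (Hinv : / (INR n + 1) < / / t).
  { apply Rinv_lt_contravar; [|lra].
    assert (0 < / t) by (now apply Rinv_0_lt_compat). nra. }
  rewrite Rinv_inv in Hinv. unfold box; cbn [fst snd]. lra.
Qed.

(** The boxes form an increasing open cover of the half-plane [t > 0]; a finite subcover has
    a largest member. *)
Lemma compact_in_box (K : R * R -> Prop) :
  compact_set (T := prod_UniformSpace R_UniformSpace R_UniformSpace) K ->
  (forall t x, K (t, x) -> 0 < t) -> exists n, forall p, K p -> box n p.
Proof.
  intros HK Hpos.
  destruct (HK (fun V => exists n, V = box n)) as [l [Hl Hcov]].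
  - intros V [n ->]. apply open_box.
  - intros [t x] Hp. destruct (box_exhausts t x (Hpos t x Hp)) as [n Hn].
    exists (box n). split; [now exists n|assumption].
  - assert (Hmax : exists N, forall V, In V l -> forall p, V p -> box N p).
    { clear Hcov. induction l as [|V l IH].
      - exists 0%nat. intros V [].
      - destruct IH as [N HN]. { intros V' HV'. apply Hl. now right. }
        destruct (Hl V (or_introl eq_refl)) as [n ->].
        exists (Nat.max n N). intros V' [<-|HV'] p Hp.
        + eapply box_mono; [apply Nat.le_max_l|exact Hp].
        + eapply box_mono; [apply Nat.le_max_r|now apply (HN V')]. }
    destruct Hmax as [N HN]. exists N. intros p Hp.
    destruct (Hcov p Hp) as [V [HV HVp]]. now apply (HN V).
Qed.

Lemma sup_over_lt_ub {T : Type} (D : T -> Prop) (g : T -> R) (eps : R) :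
  Rbar_lt (sup_over D g) eps -> forall p, D p -> g p <= eps.
Proof.
  intros H p Hp. unfold sup_over in H.
  destruct (Lub_Rbar_correct (fun r => exists p, D p /\ r = g p)) as [Hub _].
  specialize (Hub (g p) (ex_intro _ p (conj Hp eq_refl))).
  apply (Rbar_le_lt_trans _ _ _ Hub) in H. simpl in H. lra.
Qed.

Lemma sup_over_lt {T : Type} (D : T -> Prop) (g : T -> R) (eps : R) :
  0 < eps -> (forall p, D p -> g p <= eps / 2) -> Rbar_lt (sup_over D g) eps.
Proof.
  intros Heps H. apply Rbar_le_lt_trans with (Finite (eps / 2)); [|simpl; lra].
  apply (proj2 (Lub_Rbar_correct (fun r => exists p, D p /\ r = g p))).
  intros r [p [Hp ->]]. apply H, Hp.
Qed.

Theorem theorem4p6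
  (J : @matrix C 2 2) (HJ : unitary J)
  (phi : R) (alpha beta : C) (Hpar : parameters J phi alpha beta)
  (alpha0 : R) (Halpha0 : 0 < alpha0 < PI / 2)
  (Omega : C -> Prop) (HOmega : open (T := C_UniformSpace) Omega)
  (HsubOmega : forall z : C, double_sector alpha0 z -> Omega z)
  (F : C -> C) (Fn : nat -> C -> C)
  (HF : holomorphic_on Omega F)
  (HFn : forall n : nat, holomorphic_on Omega (Fn n))
  (A B : R) (HA : 0 <= A) (HB : 0 <= B)
  (An Bn : nat -> R) (HAn : forall n : nat, 0 <= An n) (HBn : forall n : nat, 0 <= Bn n)
  (HFbound : forall z : C, double_sector alpha0 z ->
     Cmod (F z) <= A * exp (B * Rabs (Im z)))
  (HFnbound : forall (n : nat) (z : C), double_sector alpha0 z ->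
     Cmod (Fn n z) <= An n * exp (Bn n * Rabs (Im z)))
  (C0 : R) (HC0 : 0 <= C0)
  (Hconv : sup_tends_to_0 (double_sector alpha0)
     (fun n z => Cmod (Fn n z - F z) * exp (- C0 * Cmod z))) :
  forall K : R * R -> Prop,
    compact_set (T := prod_UniformSpace R_UniformSpace R_UniformSpace) K ->
    (forall t x : R, K (t, x) -> 0 < t) ->
    sup_tends_to_0 (fun p : R * R => K p /\ snd p <> 0)
      (fun n p => Cmod (Psi phi alpha beta (fst p) (snd p) (Fn n)
                        - Psi phi alpha beta (fst p) (snd p) F)).
Proof.
  intros K HK Hpos eps.
  destruct (compact_in_box K HK Hpos) as [N HN].
  destruct (mu_bounded phi alpha beta) as [m [Hm0 Hm]].
  assert (HN0 := pos_INR N).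
  set (t0 := / (INR N + 1)). assert (Ht0 : 0 < t0) by (apply Rinv_0_lt_compat; lra).
  set (S := stability_const t0 (INR N + 1) (INR N + 1)
    (Rmax (Rabs (omega_plus phi alpha)) (Rabs (omega_minus phi alpha))) m (tan alpha0) C0).
  assert (Hk : 0 < tan alpha0) by (apply tan_gt_0; lra).
  assert (HS : 0 <= S).
  { unfold S, stability_const. repeat apply Rmult_le_pos; try lra.
    - now apply kernel_const_ge_0.
    - apply Rlt_le, exp_pos. }
  assert (He := cond_pos eps).
  set (delta := eps / (2 * (S + 1))).
  assert (Hdelta : 0 < delta) by (apply Rdiv_lt_0_compat; lra).
  destruct (Hconv (mkposreal delta Hdelta)) as [n0 Hn0].
  exists n0. intros n Hn. specialize (Hn0 n Hn).
  apply sup_over_lt; [assumption|]. intros [t x] [Hp Hx]. cbn [fst snd] in *.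
  destruct (HN _ Hp) as [B1 [B2 [B3 B4]]]. cbn [fst snd] in *.
  apply Rle_trans with (delta * S).
  - apply (Psi_stability phi alpha beta alpha0 Omega) with (A := An n) (B := Bn n) (A' := A) (B' := B);
      auto; try (unfold t0; lra).
    + apply Rabs_le; lra.
    + intros z Hz. assert (E := sup_over_lt_ub _ _ _ Hn0 z Hz). cbn beta in E.
      replace (- C0 * Cmod z) with (- (C0 * Cmod z)) in E by ring.
      rewrite exp_Ropp in E. exact (proj1 (Rle_div_l _ _ _ (exp_pos _)) E).
  - assert (E : delta * (S + 1) = eps / 2) by (unfold delta; field; lra). lra.
Qed.
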